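(* Let $H$ be a semisimple Hopf algebra over $k$. Then for any normal Hopf subalgebra $K$ of $H$, the pair $(K,K)$ is a Mackey pair of Hopf subalgebras of $H$.
   Context: $k$ is an algebraically closed field of characteristic zero; $H$ is a semisimple (hence finite dimensional and cosemisimple) Hopf algebra over $k$ with counit $\epsilon$. A Hopf subalgebra is normal if it is stable under the left and right adjoint actions of $H$ on itself. For subspaces $X,Y\subseteq H$, $XY$ denotes the linear span of all products $xy$. Irreducible characters of $H^*$ are viewed as elements of $H$; they correspond bijectively to simple subcoalgebras: a simple subcoalgebra $C$ with comatrix basis $(x_{ij})$, $\Delta(x_{ij})=\sum_l x_{il}\otimes x_{lj}$, corresponds to $c=\sum_i x_{ii}$; one writes $C=C_c$. $\mathrm{Irr}(H^* )$ is the set of these characters. $\Lambda_K\in K$ is the integral of $K$ with $\epsilon(\Lambda_K)=1$. Double cosets: for Hopf subalgebras $L,K$ of $H$, the relation $C\sim D$ iff $C\subseteq LDK$ is an equivalence relation on simple subcoalgebras of $H$, with $C\sim D$ iff $LCK=LDK$. A sum over $C\in L\backslash H/K$ runs over one representative simple subcoalgebra $C$ per equivalence class. Conjugate Hopf subalgebra: for a simple subcoalgebra $C$ with character $c$, ${}^CK:=\bigoplus_{d}C_d$, the sum over all $d\in\mathrm{Irr}(H^* )$ with $dc\Lambda_K=\epsilon(d)c\Lambda_K$. It is a Hopf subalgebra of $H$, and $CK$ is stable under left multiplication by ${}^CK$; for a left $K$-module $M$, ${}^CM:=CK\otimes_KM$ is a left ${}^CK$-module. Mackey pair: $(L,K)$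 is a Mackey pair if for every finite dimensional left $K$-module $M$ the (always surjective) $L$-module map $\bigoplus_{C\in L\backslash H/K}L\otimes_{L\cap{}^CK}{}^CM\to (H\otimes_KM)\downarrow^H_L$, $l\otimes(x\otimes_Km)\mapsto lx\otimes_Km$, is an isomorphism. *)

(* Defs.v *)
(* boolp and classical_sets only serve to speak of the span of an arbitrary
   set of vectors and of elements specified up to uniqueness. *)
From HB Require Import structures.
From mathcomp Require Import all_boot all_algebra falgebra.
From mathcomp Require Import boolp classical_sets.

Set Implicit Arguments.
Unset Strict Implicit.
Unset Printing Implicit Defensive.

Import GRing.Theory.
Import VectorInternalTheory.

Local Open Scope ring_scope.

Section LinearAlgebra.
Variable k : fieldType.

Definition bilin (V W U : lmodType k) (f : V -> W -> U) : Prop :=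
  (forall v, linear (f v)) /\ (forall w, linear (f^~ w)).

Section Span.
Variable V : vectType k.
Implicit Types (A : set V) (U : {vspace V}).

Definition is_vspan A U : Prop :=
  (A `<=` [set` U])%classic /\
  forall W : {vspace V}, (A `<=` [set` W])%classic -> (U <= W)%VS.

Definition vspan A : {vspace V} := xget 0%VS [set U | is_vspan A U]%classic.

Lemma is_vspan_vspan A : is_vspan A (vspan A).
Proof.
apply: xgetPex.
pose P n := `[< exists s : seq V, (forall v, v \in s -> A v) /\ \dim <<s>> = n >].
have exP : exists n, P n.
  by exists 0%N; apply/asboolP; exists [::]; rewrite span_nil dimv0.
have ubP n : P n -> (n <= \dim {:V})%N.
  by move=> /asboolP[s [_ <-]]; apply/dimvS/subvf.
case: (ex_maxnP exP ubP) => n /asboolP[s [sA <-]] maxs.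
exists <<s>>%VS; split=> [v Av /=|W AW].
  have : (<<s>> == <<v :: s>>)%VS.
    rewrite eqEdim span_cons addvSr /= -span_cons.
    apply/maxs/asboolP; exists (v :: s); split=> // w.
    by rewrite inE => /predU1P[->|/sA].
  by move/eqP->; rewrite memv_span ?mem_head.
by apply/span_subvP => v /sA /AW.
Qed.

Lemma mem_vspan A v : A v -> v \in vspan A.
Proof. by case: (is_vspan_vspan A) => AU _ /AU. Qed.

Lemma vspan_sub A U : (forall v, A v -> v \in U) -> (vspan A <= U)%VS.
Proof. by case: (is_vspan_vspan A) => _; apply. Qed.

End Span.

Section Tensor.
Variables V W : vectType k.

(* V (x) W is modelled by matrices: relative to the bases of V and W chosen by
   their vectType structures, the entries of a matrix are the coordinates of a
   tensor and u (x) w is a rank one matrix.  [tliftE], [tlift_linear] and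
   [tensor_std_sum] give the universal property. *)
Definition tensor : vectType k := 'M[k]_(dim V, dim W).

Definition tens (v : V) (w : W) : tensor := (v2r v)^T *m v2r w.

Definition std_basis (i : 'I_(dim V)) : V := r2v (delta_mx 0 i).

Lemma tens_bilin : bilin tens.
Proof.
split=> [v a w w'|w a v v']; rewrite /tens.
  by rewrite linearP /= linearP.
by rewrite !linearP /= mulmxDl scalemxAl.
Qed.

Lemma std_basisE v : v = \sum_i v2r v 0 i *: std_basis i.
Proof.
apply: v2r_inj; rewrite linear_sum /= {1}[v2r v]row_sum_delta.
by apply: eq_bigr => i _; rewrite linearZ /= r2vK.
Qed.

End Tensor.

Section TensorLift.
Variables (V W : vectType k) (U : lmodType k).

(* The linear map V (x) W -> U induced by a bilinear f; in Sweedler notation,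
   tlift f t is f(t_1, t_2) summed. *)
Definition tlift (f : V -> W -> U) (t : tensor V W) : U :=
  \sum_i \sum_j t i j *: f (std_basis i) (std_basis j).

Lemma tlift_linear f : linear (tlift f).
Proof.
move=> a s t; rewrite /tlift scaler_sumr -big_split; apply: eq_bigr => i _.
rewrite scaler_sumr -big_split; apply: eq_bigr => j _ /=.
by rewrite !mxE scalerDl scalerA.
Qed.

Lemma tliftE f v w : bilin f -> tlift f (tens v w) = f v w.
Proof.
case=> fr fl.
pose fwM w' := GRing.isLinear.Build k V U _ (f^~ w') (fl w').
pose fw w' : {linear V -> U} := HB.pack (f^~ w') (fwM w').
pose fvM v' := GRing.isLinear.Build k W U _ (f v') (fr v').
pose fv v' : {linear W -> U} := HB.pack (f v') (fvM v').
rewrite [in RHS](std_basisE v) -[RHS]/(fw w _) linear_sum.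
apply: eq_bigr => i _; rewrite linearZ_LR /= [in RHS](std_basisE w).
rewrite -[f (std_basis i) (\sum_j _)]/(fv (std_basis i) _) linear_sum scaler_sumr.
by apply: eq_bigr => j _; rewrite linearZ_LR /= scalerA !mxE big_ord1 !mxE.
Qed.

End TensorLift.

Lemma tensor_std_sum (V W : vectType k) (t : tensor V W) :
  t = \sum_i \sum_j t i j *: tens (std_basis i) (std_basis j).
Proof.
rewrite [LHS]matrix_sum_delta; apply: eq_bigr => i _; apply: eq_bigr => j _.
congr (_ *: _); rewrite /tens !r2vK trmx_delta.
by rewrite mul_delta_mx.
Qed.

Definition tmap (V W V' W' : vectType k) (f : V -> V') (g : W -> W') :
  tensor V W -> tensor V' W' := tlift (fun v w => tens (f v) (g w)).

Definition tassoc (V W U : vectType k) :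
    tensor (tensor V W) U -> tensor V (tensor W U) :=
  tlift (fun t u => tlift (fun v w => tens v (tens w u)) t).

Definition tensv (V W : vectType k) (X : {vspace V}) (Y : {vspace W}) :
    {vspace tensor V W} :=
  vspan [set t | exists v w, [/\ v \in X, w \in Y & t = tens v w]]%classic.

Section Quotient.
Variables (V : vectType k) (U : {vspace V}).

(* V / U, modelled on the complement U^C provided by the library; the class
   map is the projection along U.  [quo_class_eq0] and [quo_reprK] say that it
   is onto with kernel U. *)
Definition quov : vectType k := subvs_of U^C.
Definition quo_class (v : V) : quov := vsproj U^C (daddv_pi U^C U v).
Definition quo_repr (q : quov) : V := vsval q.

Lemma quo_class_linear : linear quo_class.
Proof. by move=> a u v; rewrite /quo_class !linearP. Qed.

Lemma quo_reprK : cancel quo_repr quo_class.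
Proof.
move=> q; rewrite /quo_class daddv_pi_id ?subvsP ?vsvalK //.
by rewrite capvC capv_compl.
Qed.

Lemma quo_class_eq0 v : (quo_class v = 0) <-> (v \in U).
Proof.
have UCU : (U^C :&: U = 0)%VS by rewrite capvC capv_compl.
have defv : daddv_pi U^C U v + daddv_pi U U^C v = v.
  by rewrite daddv_pi_add // addvC addv_complf memvf.
have quo0 : vsval (0 : quov) = 0 by exact: (@linear0 _ _ _ _ (@vsval _ _ U^C%VS)).
split=> [v0|Uv].
  have v0' : daddv_pi U^C U v = 0.
    by rewrite -[LHS](@vsprojK _ _ U^C%VS) ?memv_pi // -[RHS]quo0 -v0.
  by rewrite -defv v0' add0r memv_pi.
apply: val_inj; apply: etrans (esym quo0).
rewrite -[LHS]/(vsval _) vsprojK ?memv_pi //.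
by move: defv; rewrite (daddv_pi_id (capv_compl U) Uv) -{3}[v]add0r => /addIr.
Qed.

End Quotient.

End LinearAlgebra.

Notation "v \ox w" := (tens v w) (at level 40, left associativity) : ring_scope.

Definition tens_mul (k : fieldType) (A : falgType k) (s t : tensor A A) :
    tensor A A :=
  tlift (fun a b => tlift (fun c d => (a * c) \ox (b * d)) t) s.

HB.mixin Record Falgebra_isHopf (k : fieldType) H of Falgebra k H := {
  comul : {linear H -> tensor H H};
  counit : {scalar H};
  antipode : {linear H -> H};
  comulA : forall h : H,
    tassoc (tmap comul idfun (comul h)) = tmap idfun comul (comul h);
  counitl : forall h : H, tlift (fun a b => counit a *: b) (comul h) = h;
  counitr : forall h : H, tlift (fun a b => counit b *: a) (comul h) = h;
  comul1 : comul 1 = 1 \ox 1;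
  comulM : forall g h : H, comul (g * h) = tens_mul (comul g) (comul h);
  counit1 : counit 1 = 1;
  counitM : forall g h : H, counit (g * h) = counit g * counit h;
  antipodel : forall h : H,
    tlift (fun a b => antipode a * b) (comul h) = counit h *: 1;
  antipoder : forall h : H,
    tlift (fun a b => a * antipode b) (comul h) = counit h *: 1;
}.

#[short(type="hopfAlgType")]
HB.structure Definition HopfAlgebra (k : fieldType) :=
  { H of Falgebra_isHopf k H & Falgebra k H }.

Section Hopf.
Variables (k : fieldType) (H : hopfAlgType k).
Implicit Types (A B C D I J K L X : {vspace H}).

Definition left_ideal I : Prop := forall h x : H, x \in I -> h * x \in I.

(* The left regular module is completely reducible. *)
Definition semisimple_alg : Prop :=
  forall I, left_ideal I ->
  exists J, [/\ left_ideal J, (I + J = fullv)%VS & (I :&: J = 0)%VS].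

Definition subcoalg C : Prop := forall x : H, x \in C -> comul x \in tensv C C.

Definition hopf_subalg K : Prop :=
  [/\ 1 \in K, forall x y : H, x \in K -> y \in K -> x * y \in K,
      subcoalg K & forall x : H, x \in K -> antipode x \in K].

Definition ad_left (h x : H) : H :=
  tlift (fun a b => a * x * antipode b) (comul h).
Definition ad_right (h x : H) : H :=
  tlift (fun a b => antipode a * x * b) (comul h).

Definition normal_hopf_subalg K : Prop :=
  [/\ hopf_subalg K, forall h x : H, x \in K -> ad_left h x \in K
    & forall h x : H, x \in K -> ad_right h x \in K].

Definition simple_subcoalg C : Prop :=
  [/\ C != 0%VS, subcoalg C
    & forall D, subcoalg D -> (D <= C)%VS -> D = 0%VS \/ D = C].

Definition comatrix_basis C n (x : 'M[H]_n) : Prop :=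
  basis_of C [seq x p.1 p.2 | p : 'I_n * 'I_n] /\
  forall i j, comul (x i j) = \sum_l x i l \ox x l j.

(* The irreducible character of H^* attached to a simple subcoalgebra, as an
   element of H.  It does not depend on the comatrix basis; when k is
   algebraically closed such a basis exists, so the default value is unused. *)
Definition subcoalg_char C : H :=
  xget 0 [set c | exists n (x : 'M[H]_n), comatrix_basis C x /\ c = \tr x]%classic.

Definition norm_integral K (z : H) : Prop :=
  [/\ z \in K,
      forall x : H, x \in K -> x * z = counit x *: z /\ z * x = counit x *: z
    & counit z = 1].

(* Two-sided normalized integrals are unique: z = z z' = z'. *)
Definition integral K : H := xget 0 [set z | norm_integral K z]%classic.

(* ^C K.  The sum over Irr(H^* ) is indexed by the corresponding simple
   subcoalgebras; distinct simple subcoalgebras are in direct sum. *)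
Definition conj_hopf C K : {vspace H} :=
  vspan [set x | exists D,
    [/\ simple_subcoalg D, x \in D &
        let c := subcoalg_char C in let d := subcoalg_char D in
        d * c * integral K = counit d *: (c * integral K)]]%classic.

Definition dcoset_rel L K C D : Prop := (C <= L * D * K)%VS.

Definition dcoset_reps L K n (C : 'I_n -> {vspace H}) : Prop :=
  [/\ forall i, simple_subcoalg (C i),
      forall D, simple_subcoalg D -> exists i, dcoset_rel L K D (C i)
    & forall i j, dcoset_rel L K (C i) (C j) -> i = j].

(* Actions of a subalgebra A of H are total functions on subvs_of A; for a, b
   in subvs_of A the product a * b is computed in H and put back in subvs_of A
   by vsproj A, and likewise below for other products known to stay in a
   subspace. *)
Definition lmodule_over A (M : vectType k) (act : subvs_of A -> M -> M) : Prop :=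
  [/\ bilin act, forall m, act (vsproj A 1) m = m
    & forall a b m, act (vsproj A (vsval a * vsval b)) m = act a (act b m)].

Definition res_action A B (M : vectType k) (act : subvs_of B -> M -> M) :
    subvs_of A -> M -> M :=
  fun a => act (vsproj B (vsval a)).

Section RelativeTensor.
Variables (A X : {vspace H}) (M : vectType k) (act : subvs_of A -> M -> M).

(* X (x)_A M, for a subspace X of H with X A <= X and a left A-module M. *)
Definition bal_rel : {vspace tensor (subvs_of X) M} :=
  vspan [set t | exists x a m,
    t = vsproj X (vsval x * vsval a) \ox m - x \ox act a m]%classic.

Definition btensor : vectType k := quov bal_rel.

(* The class of x (x) m; only meaningful for x in X. *)
Definition btens (x : H) (m : M) : btensor :=
  quo_class bal_rel (vsproj X x \ox m).

Lemma btens_bal (x : H) (a : subvs_of A) (m : M) : x \in X ->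
  btens (x * vsval a) m = btens x (act a m).
Proof.
move=> Xx; apply/eqP; rewrite -subr_eq0 /btens.
have qB u v : quo_class bal_rel u - quo_class bal_rel v = quo_class bal_rel (u - v).
  by rewrite -scaleN1r addrC -(quo_class_linear bal_rel) scaleN1r addrC.
rewrite qB; apply/eqP/quo_class_eq0/mem_vspan.
by exists (vsproj X x), a, m; rewrite vsprojK.
Qed.

(* Left multiplication by B on X (x)_A M, when B X <= X. *)
Definition btensor_act (B : {vspace H}) (b : subvs_of B) (t : btensor) : btensor :=
  tlift (fun x m => btens (vsval b * vsval x) m) (quo_repr t).

End RelativeTensor.

Section Mackey.
Variables (L K : {vspace H}) (M : vectType k) (act : subvs_of K -> M -> M).

Definition conj_mod C : vectType k := btensor (C * K)%VS act.

Definition conj_act C : subvs_of (conj_hopf C K) -> conj_mod C -> conj_mod C :=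
  @btensor_act K (C * K)%VS M act (conj_hopf C K).

Definition mackey_act C :
    subvs_of (L :&: conj_hopf C K)%VS -> conj_mod C -> conj_mod C :=
  res_action (@conj_act C).

Definition mackey_summand C : vectType k := btensor L (@mackey_act C).

Definition induced : vectType k := btensor {:H} act.

Definition mackey_pure C (l x : H) (m : M) : mackey_summand C :=
  btens L (@mackey_act C) l (btens (C * K)%VS act x m).

End Mackey.

(* The map out of the direct sum is given by its components f i, which the
   formula on generators determines; elements of the direct sum are the
   dependent finite families u. *)
Definition mackey_pair L K : Prop :=
  forall (M : vectType k) (act : subvs_of K -> M -> M), lmodule_over act ->
  forall n (C : 'I_n -> {vspace H}), dcoset_reps L K C ->
  exists f : forall i : 'I_n, {linear mackey_summand L act (C i) -> induced act},
    [/\ forall i (l x : H) m, l \in L -> x \in (C i * K)%VS ->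
          f i (mackey_pure L act (C i) l x m) = btens {:H} act (l * x) m,
        forall i (l : subvs_of L) t,
          f i (btensor_act l t) = btensor_act l (f i t)
      & bijective (fun u : {dffun forall i, mackey_summand L act (C i)} =>
          \sum_i f i (u i))].

End Hopf.

(* Main.v *)
(* For K = k1 the theorem says that H is the direct sum of its simple
   subcoalgebras, so it contains the theorem of Larson and Radford that a
   semisimple Hopf algebra in characteristic 0 is cosemisimple.  To prove the
   latter, let L be the two-sided integral of H with eps(L) = 1 and lam the
   integral of the dual with lam(L) = 1; it suffices that lam(1) = Tr(S^2) is not
   zero.  Since H is unimodular, S^4 is conjugation by the distinguished
   grouplike element, which has finite order.  The Nakayama automorphism of lam
   is inverse to S^2, and comparing lam with the (nondegenerate) character of
   the regular representation shows that S^2 is inner, say conjugation by v.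
   Then a power v^n is central, and Tr(S^2) is the sum over the blocks z of H of
   the tr(v z) tr(v^-1 z) / dim(z H): up to a positive rational number, each term
   is the squared absolute value of a sum of n-th roots of unity.  The block of L
   contributes 1, hence the sum is not zero.

   Now let lam(1) = 1.  With respect to the form lam(S(x) y) the orthogonal of a
   subcoalgebra is a subcoalgebra, so every subcoalgebra is a sum of simple ones.
   If K is normal then K C = C K for every subcoalgebra C and the integral of K is
   central in H, so K is contained in ^C K and the summand of C is C K (x)_K M.
   Finally the C_i K are pairwise orthogonal and span H, so H is their direct sum
   as a right K-module. *)
Require Import Defs.
From mathcomp Require Import all_boot all_algebra falgebra.
From HB Require Import structures.
From mathcomp Require Import boolp.
From mathcomp Require order perm cyclic separable cyclotomic.

Set Implicit Arguments.
Unset Strict Implicit.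
Unset Printing Implicit Defensive.

Import GRing.Theory.
Import VectorInternalTheory.
Local Open Scope ring_scope.

(** * Sweedler calculus *)

Section Linear.
Variable k : fieldType.

Definition to_linear (V W : lmodType k) (f : V -> W) (lf : linear f) :
    {linear V -> W} :=
  HB.pack f (GRing.isLinear.Build k V W _ f lf).

Lemma linear_id (V : lmodType k) : linear (fun x : V => x).
Proof. by []. Qed.

Lemma linear_app (V W U : lmodType k) (L : {linear W -> U}) (f : V -> W) :
  linear f -> linear (fun x => L (f x)).
Proof. by move=> lf a u v; rewrite lf linearP. Qed.

Lemma linear_mull (V : lmodType k) (A : algType k) (c : A) (f : V -> A) :
  linear f -> linear (fun x => c * f x).
Proof. by move=> lf a u v; rewrite lf mulrDr scalerAr. Qed.

Lemma linear_mulr (V : lmodType k) (A : algType k) (c : A) (f : V -> A) :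
  linear f -> linear (fun x => f x * c).
Proof. by move=> lf a u v; rewrite lf mulrDl scalerAl. Qed.

Lemma linear_scalel (V W : lmodType k) (c : W) (f : V -> k^o) :
  linear f -> linear (fun x => f x *: c).
Proof. by move=> lf a u v; rewrite lf scalerDl -scalerA. Qed.

Lemma linear_scaler (V W : lmodType k) (c : k) (f : V -> W) :
  linear f -> linear (fun x => c *: f x).
Proof. by move=> lf a u v; rewrite lf scalerDr !scalerA mulrC. Qed.

Lemma linear_add (V W : lmodType k) (f g : V -> W) :
  linear f -> linear g -> linear (fun x => f x + g x).
Proof. by move=> lf lg a u v; rewrite lf lg scalerDr addrACA. Qed.

Lemma linear_opp (V W : lmodType k) (f : V -> W) :
  linear f -> linear (fun x => - f x).
Proof. by move=> lf a u v; rewrite lf opprD scalerN. Qed.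

Lemma linear_tensl (V W U : vectType k) (f : U -> V) (w : W) :
  linear f -> linear (fun x => f x \ox w).
Proof. by move=> lf a u v; rewrite lf (tens_bilin V W).2. Qed.

Lemma linear_tensr (V W U : vectType k) (f : U -> W) (v : V) :
  linear f -> linear (fun x => v \ox f x).
Proof. by move=> lf a u u'; rewrite lf (tens_bilin V W).1. Qed.

Lemma linear_bilinl (V W X U : lmodType k) (F : V -> W -> U) (f : X -> V) w :
  bilin F -> linear f -> linear (fun x => F (f x) w).
Proof. by move=> [_ lF] lf a u v; rewrite lf lF. Qed.

Lemma linear_bilinr (V W X U : lmodType k) (F : V -> W -> U) (f : X -> W) v :
  bilin F -> linear f -> linear (fun x => F v (f x)).
Proof. by move=> [lF _] lf a u u'; rewrite lf lF. Qed.

Lemma linear_tlift_arg (V W : vectType k) (U X : lmodType k)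
    (F : V -> W -> U) (f : X -> tensor V W) :
  linear f -> linear (fun x => tlift F (f x)).
Proof. by move=> lf a u v; rewrite lf (tlift_linear F). Qed.

Lemma linear_tlift_fun (V W : vectType k) (U X : lmodType k)
    (F : X -> V -> W -> U) (t : tensor V W) :
  (forall v w, linear (fun x => F x v w)) -> linear (fun x => tlift (F x) t).
Proof.
move=> lF a x y; rewrite /tlift scaler_sumr -big_split; apply: eq_bigr => i _.
rewrite scaler_sumr -big_split; apply: eq_bigr => j _ /=.
by rewrite lF scalerDr !scalerA mulrC.
Qed.

Lemma eq_tlift (V W : vectType k) (U : lmodType k) (F G : V -> W -> U) t :
  (forall v w, F v w = G v w) -> tlift F t = tlift G t.
Proof.
by move=> eqFG; apply: eq_bigr => i _; apply: eq_bigr => j _; rewrite eqFG.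
Qed.

Lemma linear_tlift (V W : vectType k) (U X : lmodType k)
    (L : U -> X) (F : V -> W -> U) t :
  linear L -> L (tlift F t) = tlift (fun v w => L (F v w)) t.
Proof.
move=> lL; rewrite -[LHS]/(to_linear lL _) linear_sum; apply: eq_bigr => i _.
by rewrite linear_sum; apply: eq_bigr => j _; rewrite linearZ.
Qed.

Lemma tlift_exchange (V W V' W' : vectType k) (U : lmodType k)
    (F : V -> W -> V' -> W' -> U) s t :
  tlift (fun v w => tlift (F v w) t) s
  = tlift (fun v' w' => tlift (fun v w => F v w v' w') s) t.
Proof.
rewrite /tlift; pose G i j i' j' := s i j *: (t i' j' *: F (std_basis i) (std_basis j)
  (std_basis i') (std_basis j')).
transitivity (\sum_i \sum_j \sum_i' \sum_j' G i j i' j').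
  apply: eq_bigr => i _; apply: eq_bigr => j _.
  by rewrite scaler_sumr; apply: eq_bigr => i' _; rewrite scaler_sumr.
transitivity (\sum_i \sum_i' \sum_j \sum_j' G i j i' j').
  by apply: eq_bigr => i _; rewrite exchange_big.
rewrite exchange_big; apply: eq_bigr => i' _ /=.
transitivity (\sum_i \sum_j' \sum_j G i j i' j').
  by apply: eq_bigr => i _; rewrite exchange_big.
rewrite exchange_big; apply: eq_bigr => j' _ /=.
rewrite scaler_sumr; apply: eq_bigr => i _; rewrite scaler_sumr.
by apply: eq_bigr => j _; rewrite /G !scalerA mulrC.
Qed.

Lemma tlift_tens (V W V' W' : vectType k) (U : lmodType k)
    (F : V' -> W' -> U) (p : V -> W -> V') (q : V -> W -> W') t :
  bilin F ->
  tlift F (tlift (fun v w => p v w \ox q v w) t)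
  = tlift (fun v w => F (p v w) (q v w)) t.
Proof.
move=> bF; rewrite (linear_tlift _ _ (tlift_linear F)).
by apply: eq_tlift => v w; rewrite tliftE.
Qed.

Lemma tlift_sum (V W : vectType k) (U : lmodType k) I (r : seq I)
    (F : I -> V -> W -> U) t :
  tlift (fun v w => \sum_(i <- r) F i v w) t = \sum_(i <- r) tlift (F i) t.
Proof.
rewrite /tlift; under eq_bigr do under eq_bigr do rewrite scaler_sumr.
under eq_bigr do rewrite exchange_big.
by rewrite exchange_big.
Qed.

Lemma tliftB (V W : vectType k) (U : lmodType k) (F G : V -> W -> U) t :
  tlift (fun v w => F v w - G v w) t = tlift F t - tlift G t.
Proof.
rewrite -sumrB; apply: eq_bigr => i _; rewrite -sumrB.
by apply: eq_bigr => j _; rewrite scalerBr.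
Qed.

Lemma tlift0 (V W : vectType k) (U : lmodType k) (t : tensor V W) :
  tlift (fun _ _ => 0 : U) t = 0.
Proof. by rewrite /tlift big1 // => i _; rewrite big1 // => j _; rewrite scaler0. Qed.

End Linear.

Section Sweedler.
Variables (k : fieldType) (H : hopfAlgType k).
Implicit Types (g h : H).

(* The counit, with values in k^o so as to be an instance of
   {linear H -> k^o}. *)
Definition eps : {linear H -> k^o} :=
  to_linear (linearP (counit : {linear H -> k^o})).
Local Notation S := (@antipode k H).

(* In Sweedler notation, sw F h is the sum of the F(h_1, h_2). *)
Definition sw (U : lmodType k) (F : H -> H -> U) h := tlift F (comul h).

Lemma linear_sw_arg (X U : lmodType k) (F : H -> H -> U) (f : X -> H) :
  linear f -> linear (fun x => sw F (f x)).
Proof. by move=> lf; apply: linear_tlift_arg; apply: linear_app. Qed.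

Lemma linear_sw_fun (X U : lmodType k) (F : X -> H -> H -> U) h :
  (forall a b, linear (fun x => F x a b)) -> linear (fun x => sw (F x) h).
Proof. by move=> lF; apply: linear_tlift_fun. Qed.

Lemma eq_sw (U : lmodType k) (F G : H -> H -> U) h :
  (forall a b, F a b = G a b) -> sw F h = sw G h.
Proof. exact: eq_tlift. Qed.

Lemma linear_sw (U V : lmodType k) (L : U -> V) (F : H -> H -> U) h :
  linear L -> L (sw F h) = sw (fun a b => L (F a b)) h.
Proof. exact: linear_tlift. Qed.

Lemma sw_exchange (U : lmodType k) (F : H -> H -> H -> H -> U) g h :
  sw (fun a b => sw (F a b) h) g = sw (fun c d => sw (fun a b => F a b c d) g) h.
Proof. exact: tlift_exchange. Qed.

End Sweedler.

(** Each Sweedler manipulation below asks for linearity in every leg; these side conditions are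
    solved by recursion on the shape of the expression. *)
Ltac prove_linear :=
  repeat (cbv beta; match goal with
  | |- bilin _ => split
  | |- forall _, _ => intro
  | |- linear _ => first
     [ exact: linear_id
     | assumption
     | exact: linearP
     | match goal with hyp : _ |- _ => exact: hyp end
     | apply: linear_sw_arg
     | apply: linear_sw_fun => ? ?
     | apply: linear_tensl | apply: linear_tensr
     | apply: linear_tlift_arg
     | apply: linear_tlift_fun => ? ?
     | apply: linear_mull | apply: linear_mulr
     | apply: linear_scalel | apply: linear_scaler
     | apply: linear_add | apply: linear_opp
     | apply: linear_app
     | match goal with bF : bilin ?F |- _ =>
         first [apply: (linear_bilinl _ bF) | apply: (linear_bilinr _ bF)] end
     ]
  end).

Section SweedlerRules.
Variables (k : fieldType) (H : hopfAlgType k).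
Implicit Types (g h : H).
Local Notation eps := (eps H).
Local Notation S := (@antipode k H).

(** A trilinear [F] induces a linear map on the triple tensor product, and the two sides are the
    images under it of the two sides of [comulA]. *)
Lemma sw_assoc (U : lmodType k) (F : H -> H -> H -> U) h :
    (forall b c, linear (fun a => F a b c)) ->
    (forall a c, linear (fun b => F a b c)) ->
    (forall a b, linear (fun c => F a b c)) ->
  sw (fun a c => sw (fun a b => F a b c) a) h
  = sw (fun a b => sw (fun b c => F a b c) b) h.
Proof.
move=> lF1 lF2 lF3.
have bF x : bilin (F x) by prove_linear.
have bbF : bilin (fun x => tlift (F x)) by prove_linear.
have := congr1 (tlift (fun x => tlift (F x))) (comulA h).
rewrite /tassoc /tmap (@tlift_tens _ _ _ _ _ _ (fun t u => tlift (fun v w : H =>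
  tens v (tens w u)) t)); last by prove_linear.
rewrite (tlift_tens _ _ _ bbF) (linear_tlift _ _ (tlift_linear _)) => E.
transitivity (tlift (fun x => tlift (F x)) (tlift (fun (v : H) w =>
   tlift (fun v0 w0 : H => v0 \ox (w0 \ox idfun w)) (comul v)) (comul h))).
  rewrite (linear_tlift _ _ (tlift_linear _)); apply: eq_tlift => a c.
  rewrite (tlift_tens _ _ _ bbF); apply: eq_tlift => v w.
  by rewrite tliftE.
by rewrite (linear_tlift _ _ (tlift_linear _)) E.
Qed.

Lemma sw_counitl (U : lmodType k) (f : H -> U) h :
  linear f -> sw (fun a b => eps a *: f b) h = f h.
Proof.
move=> lf; rewrite -[in RHS](counitl h) (linear_tlift _ _ lf).
by apply: eq_tlift => a b; rewrite -[RHS]/(to_linear lf _) linearZ.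
Qed.

Lemma sw_counitr (U : lmodType k) (f : H -> U) h :
  linear f -> sw (fun a b => eps b *: f a) h = f h.
Proof.
move=> lf; rewrite -[in RHS](counitr h) (linear_tlift _ _ lf).
by apply: eq_tlift => a b; rewrite -[RHS]/(to_linear lf _) linearZ.
Qed.

Lemma sw1 (U : lmodType k) (F : H -> H -> U) : bilin F -> sw F 1 = F 1 1.
Proof. by move=> bF; rewrite /sw comul1 tliftE. Qed.

Lemma swM (U : lmodType k) (F : H -> H -> U) g h : bilin F ->
  sw F (g * h) = sw (fun a b => sw (fun c d => F (a * c) (b * d)) h) g.
Proof.
move=> bF; rewrite /sw comulM /tens_mul (linear_tlift _ _ (tlift_linear F)).
by apply: eq_tlift => a b; rewrite tlift_tens.
Qed.

Lemma sw_antipodel (U : lmodType k) (f : H -> U) h :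
  linear f -> sw (fun a b => f (S a * b)) h = eps h *: f 1.
Proof.
move=> lf; have -> : eps h *: f 1 = f (counit h *: 1).
  by rewrite -[RHS]/(to_linear lf _) linearZ.
by rewrite -antipodel (linear_tlift _ _ lf).
Qed.

Lemma sw_antipoder (U : lmodType k) (f : H -> U) h :
  linear f -> sw (fun a b => f (a * S b)) h = eps h *: f 1.
Proof.
move=> lf; have -> : eps h *: f 1 = f (counit h *: 1).
  by rewrite -[RHS]/(to_linear lf _) linearZ.
by rewrite -antipoder (linear_tlift _ _ lf).
Qed.

Lemma eps1 : eps 1 = 1 :> k. Proof. exact: (@counit1 k H). Qed.

Lemma epsM g h : eps (g * h) = eps g * eps h :> k.
Proof. exact: (@counitM k H). Qed.

Lemma sw_id_antipodel (U : lmodType k) (F : H -> H -> U) h : bilin F ->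
  sw (fun a b => sw (fun c d => F a (S c * d)) b) h = F h 1.
Proof.
move=> bF; transitivity (sw (fun a b => eps b *: F a 1) h).
  by apply: eq_sw => a b; rewrite (@sw_antipodel _ (F a)); prove_linear.
by rewrite sw_counitr; prove_linear.
Qed.

Lemma sw_id_antipoder (U : lmodType k) (F : H -> H -> U) h : bilin F ->
  sw (fun a b => sw (fun c d => F a (c * S d)) b) h = F h 1.
Proof.
move=> bF; transitivity (sw (fun a b => eps b *: F a 1) h).
  by apply: eq_sw => a b; rewrite (@sw_antipoder _ (F a)); prove_linear.
by rewrite sw_counitr; prove_linear.
Qed.

Lemma sw_antipoder_id (U : lmodType k) (F : H -> H -> U) h : bilin F ->
  sw (fun a b => sw (fun c d => F (c * S d) b) a) h = F 1 h.
Proof.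
move=> bF; transitivity (sw (fun a b => eps a *: F 1 b) h).
  by apply: eq_sw => a b; rewrite (@sw_antipoder _ (F^~ b)); prove_linear.
by rewrite sw_counitl; prove_linear.
Qed.

Lemma antipode1 : S 1 = 1.
Proof.
by have := @sw_antipodel _ id 1 (@linear_id _ _); rewrite sw1 ?mulr1 ?eps1 ?scale1r //;
  prove_linear.
Qed.

(** Evaluate S(g_1 h_1) g_2 h_2 S(h_3) S(g_3) in two ways: collapsing h_2 S(h_3) and then g_2 S(g_3)
    leaves S(g h), while collapsing S(g_1 h_1) (g_2 h_2) leaves S(h) S(g). *)
Lemma antipodeM g h : S (g * h) = S h * S g.
Proof.
pose E := sw (fun g1 g' => sw (fun h1 h' => sw (fun g2 g3 => sw (fun h2 h3 =>
  S (g1 * h1) * (g2 * (h2 * S h3) * S g3)) h') g') h) g.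
have E1 : E = S (g * h).
  transitivity (sw (fun g1 g' => sw (fun g2 g3 => S (g1 * h) * (g2 * S g3)) g') g).
    apply: eq_sw => g1 g'; rewrite sw_exchange; apply: eq_sw => g2 g3.
    by rewrite (@sw_id_antipoder _ (fun h1 x => S (g1 * h1) * (g2 * x * S g3))) ?mulr1
      //; prove_linear.
  by rewrite (@sw_id_antipoder _ (fun g1 x => S (g1 * h) * x)) ?mulr1 //; prove_linear.
rewrite -E1 /E.
transitivity (sw (fun g1 g' => sw (fun g2 g3 => sw (fun h1 h' => sw (fun h2 h3 =>
  S (g1 * h1) * (g2 * h2) * (S h3 * S g3)) h') h) g') g).
    apply: eq_sw => g1 g'; rewrite sw_exchange; apply: eq_sw => g2 g3.
  by apply: eq_sw => h1 h'; apply: eq_sw => h2 h3; rewrite !mulrA.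
rewrite -(@sw_assoc _ (fun g1 g2 g3 => sw (fun h1 h' => sw (fun h2 h3 =>
  S (g1 * h1) * (g2 * h2) * (S h3 * S g3)) h') h)); try by prove_linear.
transitivity (sw (fun g0 g3 => sw (fun h0 h3 => sw (fun x y => S x * y * (S h3 * S g3))
  (g0 * h0)) h) g).
  apply: eq_sw => g0 g3.
  transitivity (sw (fun g1 g2 => sw (fun h0 h3 => sw (fun h1 h2 =>
    S (g1 * h1) * (g2 * h2) * (S h3 * S g3)) h0) h) g0).
    apply: eq_sw => g1 g2; symmetry.
    by apply: (@sw_assoc _ (fun h1 h2 h3 => S (g1 * h1) * (g2 * h2) * (S h3 * S g3)));
      prove_linear.
  rewrite sw_exchange; apply: eq_sw => h0 h3.
  by rewrite swM //; prove_linear.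
transitivity (@sw k H H (fun g0 g3 => (eps g0 : k) *: @sw k H H (fun h0 h3 =>
  (eps h0 : k) *: (S h3 * S g3)) h) g).
  apply: eq_sw => g0 g3; rewrite (linear_sw _ _ (linear_scaler _ (@linear_id _ _))).
  apply: eq_sw => h0 h3.
  rewrite (@sw_antipodel _ (fun x => x * (S h3 * S g3))); last by prove_linear.
  by rewrite mul1r epsM scalerA.
by rewrite (@sw_counitl _ (fun g3 => @sw k H H (fun h0 h3 =>
  (eps h0 : k) *: (S h3 * S g3)) h)) ?sw_counitl //; prove_linear.
Qed.

Lemma eps_antipode h : eps (S h) = eps h.
Proof.
have := @sw_antipodel _ eps h (linearP _); rewrite eps1 [RHS]mulr1 => <-.
rewrite -[in LHS](@sw_counitr _ id h (@linear_id _ _)) (linear_sw _ _ (linear_app S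
  (@linear_id _ _))).
rewrite (linear_sw _ _ (linearP _)); apply: eq_sw => a b.
by rewrite epsM !linearZ /= mulrC.
Qed.

(** Evaluate Delta(S(h_1)) Delta(h_2) (S(h_4) \ox S(h_3)) in two ways: S(h_1) h_2 collapses to the
    counit, and so does h_2 against S(h_3) and S(h_4), from the inside outwards. *)
Lemma sw_antipode (U : lmodType k) (F : H -> H -> U) h : bilin F ->
  sw F (S h) = sw (fun a b => F (S b) (S a)) h.
Proof.
move=> bF; symmetry.
have lFl a : linear (F a) by prove_linear.
have lFr b : linear (F^~ b) by prove_linear.
pose G h1 h2 h3 h4 := sw (fun p q => sw (fun r s =>
  F (p * r * S h4) (q * s * S h3)) h2) (S h1).
transitivity (sw (fun h1 h' => sw (fun h2 h'' => sw (fun h3 h4 =>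
  G h1 h2 h3 h4) h'') h') h).
  rewrite -(@sw_assoc _ (fun h1 h2 h'' => sw (G h1 h2) h'')); try by rewrite /G;
    prove_linear.
  transitivity (sw (fun h0 h'' => eps h0 *: sw (fun h3 h4 => F (S h4) (S h3)) h'') h).
    by rewrite (@sw_counitl _ (sw (fun h3 h4 => F (S h4) (S h3)))) //; prove_linear.
  apply: eq_sw => h0 h''.
  transitivity (sw (fun h1 h2 => sw (fun p q => sw (fun h3 h4 =>
    F (p * S h4) (q * S h3)) h'') (S h1 * h2)) h0).
    rewrite (@sw_antipodel _ (sw (fun p q => sw (fun h3 h4 =>
      F (p * S h4) (q * S h3)) h''))).
      rewrite sw1; last by prove_linear.
      by congr (_ *: _); apply: eq_sw => a b; rewrite !mul1r.
    by prove_linear.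
  apply: eq_sw => h1 h2; rewrite swM; last by prove_linear.
  rewrite /G; rewrite [in RHS]sw_exchange; apply: eq_sw => p q.
  by rewrite [in RHS]sw_exchange.
transitivity (sw (fun h1 h' => sw (fun h2 h'' => sw (fun p q =>
  F (p * (h2 * S h'')) q) (S h1)) h') h).
  apply: eq_sw => h1 h'.
  transitivity (sw (fun r h'' => sw (fun h0 h4 => sw (fun s h3 => sw (fun p q =>
    F (p * r * S h4) (q * (s * S h3))) (S h1)) h0) h'') h').
    pose Q r s h3 h4 := sw (fun p q => F (p * r * S h4) (q * (s * S h3))) (S h1).
    have lQ1 s h3 h4 : linear (fun r => Q r s h3 h4) by rewrite /Q; prove_linear.
    have lQ2 r h3 h4 : linear (fun s => Q r s h3 h4) by rewrite /Q; prove_linear.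
    have lQ3 r s h4 : linear (fun h3 => Q r s h3 h4) by rewrite /Q; prove_linear.
    have lQ4 r s h3 : linear (fun h4 => Q r s h3 h4) by rewrite /Q; prove_linear.
    transitivity (sw (fun h2 h'' => sw (fun r s => sw (fun h3 h4 =>
      Q r s h3 h4) h'') h2) h').
      apply: eq_sw => h2 h''; rewrite [in RHS]sw_exchange; apply: eq_sw => h3 h4.
      rewrite /G sw_exchange; apply: eq_sw => r s; apply: eq_sw => p q.
      by rewrite !mulrA.
    rewrite (@sw_assoc _ (fun r s h'' => sw (fun h3 h4 => Q r s h3 h4) h''));
      try by prove_linear.
    apply: eq_sw => r t; symmetry.
    by apply: (@sw_assoc _ (Q r)); prove_linear.
  apply: eq_sw => r h''.
  rewrite (@sw_antipoder_id _ (fun x h4 => sw (fun p q =>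
    F (p * r * S h4) (q * x)) (S h1))); last by prove_linear.
  by apply: eq_sw => p q; rewrite mulr1 mulrA.
rewrite (@sw_id_antipoder _ (fun h1 x => sw (fun p q => F (p * x) q) (S h1)));
  last by prove_linear.
by apply: eq_sw => p q; rewrite mulr1.
Qed.

End SweedlerRules.

(** * Integrals *)

Section Semisimple.
Variables (k : fieldType) (H : hopfAlgType k).
Local Notation eps := (eps H).

Definition two_sided_integral (z : H) : Prop :=
  [/\ forall h, h * z = (eps h : k) *: z,
      forall h, z * h = (eps h : k) *: z & eps z = 1 :> k].

(** Write 1 = e + f along [I] and a complementary left ideal [J]; for x in [I] the element x f = x -
    x e lies in both. *)
Lemma left_ideal_idempotent (I : {vspace H}) :
    semisimple_alg H -> left_ideal I ->
  exists2 e, e \in I & forall x, x \in I -> x * e = x.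
Proof.
move=> ss lI; have [J [lJ IJ1 IJ0]] := ss I lI.
have /memv_addP[e Ie [f Jf ef1]] : 1 \in (I + J)%VS by rewrite IJ1 memvf.
exists e => // x Ix.
have xE : x = x * e + x * f by rewrite -mulrDr -ef1 mulr1.
suff: x * f \in (I :&: J)%VS.
  by rewrite IJ0 memv0 => /eqP xf0; rewrite [RHS]xE xf0 addr0.
rewrite memv_cap (lJ x f) // andbT.
have -> : x * f = x - x * e by rewrite {2}xE addrC addKr.
by rewrite memvB // lI.
Qed.

(** If e is a right unit of the left ideal ker eps, then h - eps(h) 1 lies in that ideal and is
    killed by 1 - e on the right; so 1 - e is a left integral, and it remains to see that it is a
    right one. *)
Lemma exists_integral : semisimple_alg H -> exists z, two_sided_integral z.
Proof.
move=> ss.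
have memI x : (x \in lker (linfun eps)) = (eps x == 0).
  by rewrite memv_ker lfunE.
have lI : left_ideal (lker (linfun eps)).
  by move=> h x; rewrite !memI epsM => /eqP->; rewrite mulr0.
have [e Ie eE] := left_ideal_idempotent ss lI.
have /eqP eps_e : eps e == 0 by rewrite -memI.
have L_l h : h * (1 - e) = (eps h : k) *: (1 - e).
  suff: (h - (eps h : k) *: 1) * (1 - e) = 0.
    by rewrite mulrBl -scalerAl mul1r => /eqP; rewrite subr_eq0 => /eqP.
  rewrite mulrBr mulr1 eE ?subrr // memI linearB linearZ /= -/eps.
  by rewrite -[eps h *: eps 1]/(eps h * eps 1 : k) eps1 mulr1 subrr.
exists (1 - e); split=> //; last by rewrite linearB /= -/eps eps_e subr0 eps1.
suff L_r x : eps x = 0 -> (1 - e) * x = 0.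
  move=> h; have := L_r (h - (eps h : k) *: 1).
  rewrite mulrBr -scalerAr mulr1 linearB linearZ /= -/eps.
  rewrite -[eps h *: eps 1]/(eps h * eps 1 : k) eps1 mulr1 subrr => /(_ erefl) /eqP.
  by rewrite subr_eq0 => /eqP.
(* Again a left integral, so its line is a left ideal and has a right unit c n; but n n = eps(n) n =
   0, which forces n = 0. *)
move=> x0; set n := (1 - e) * x.
have hn h : h * n = (eps h : k) *: n by rewrite mulrA L_l scalerAl.
have ln : left_ideal <[n]>.
  by move=> h y /vlineP[c ->]; rewrite -scalerAr hn !memvZ ?memv_line.
have [d /vlineP[c ->] dE] := left_ideal_idempotent ss ln.
have := dE n (memv_line n).
by rewrite -scalerAr hn epsM x0 mulr0 scale0r scaler0.
Qed.

End Semisimple.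

(** * Casimir identities for the integral *)

Section Frobenius.
Variables (k : fieldType) (H : hopfAlgType k).
Implicit Types (g h x y : H).
Local Notation eps := (eps H).
Local Notation S := (@antipode k H).

(* H is identified with its dual through the coordinates on [std_basis]. *)
Definition dot_fun x y : k^o := \sum_i v2r x 0 i * v2r y 0 i.

Lemma dot_linear x : linear (dot_fun x).
Proof.
move=> a y z; rewrite /dot_fun scaler_sumr -big_split; apply: eq_bigr => i _ /=.
by rewrite linearP !mxE mulrDr mulrCA.
Qed.

Definition dot x : {linear H -> k^o} := to_linear (dot_linear x).

Lemma dot_linearl y : linear (fun x => dot x y).
Proof.
move=> a x z; rewrite /dot /= /dot_fun scaler_sumr -big_split.
by apply: eq_bigr => i _ /=; rewrite linearP !mxE mulrDl -mulrA.
Qed.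

Lemma dot_std (x : H) i : dot (std_basis i) x = v2r x 0 i.
Proof.
rewrite /dot /= /dot_fun (bigD1 i) //= r2vK mxE !eqxx mul1r big1 ?addr0 // => j ji.
by rewrite mxE eqxx (negPf ji) mul0r.
Qed.

Lemma dual_dot (f : {linear H -> k^o}) : exists x, forall y, f y = dot x y.
Proof.
exists (r2v (\row_i f (std_basis i))) => y.
rewrite {1}(std_basisE y) linear_sum; apply: eq_bigr => i _.
by rewrite linearZ r2vK mxE mulrC.
Qed.

Lemma dual_eq x y : (forall f : {linear H -> k^o}, f x = f y) -> x = y.
Proof.
by move=> fxy; apply/v2r_inj/rowP => i; rewrite -!dot_std fxy.
Qed.

Lemma inj_surj (T : {linear H -> H}) :
  (forall x, T x = 0 -> x = 0) -> forall y, exists x, T x = y.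
Proof.
move=> injT y.
have kT : lker (linfun T) == 0%VS.
  apply/eqP/vspaceP => x; rewrite memv_ker lfunE memv0 /=.
  by apply/eqP/eqP => [/injT//|->]; rewrite linear0.
exists ((linfun T)^-1%VF y).
by have := lker0_lfunVK kT y; rewrite lfunE.
Qed.

Lemma surj_inj (T : {linear H -> H}) :
  (forall y, exists x, T x = y) -> forall x, T x = 0 -> x = 0.
Proof.
move=> surjT x Tx0.
have imT : limg (linfun T) = fullv.
  apply/vspaceP => y; rewrite memvf; have [z <-] := surjT y.
  by rewrite -(lfunE T) memv_img ?memvf.
have := limg_ker_dim (linfun T) fullv; rewrite imT capfv.
move/eqP; rewrite -[X in _ == X]add0n eqn_add2r dimv_eq0 => /eqP k0.
by apply/eqP; rewrite -memv0 -k0 memv_ker lfunE /= Tx0.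
Qed.

(** Expand the second leg in the standard basis: the term of index i is the i-th coordinate of the
    vanishing slice taken at h = Q(e_i). *)
Lemma slice0 (G : H -> H -> k^o) (Q : H -> H) t :
    (forall a, linear (G a)) -> linear Q ->
    (forall h, sw (fun a b => (G a h : k) *: b) t = 0) ->
  sw (fun a b => G a (Q b)) t = 0.
Proof.
move=> lG lQ G0.
transitivity (sw (fun a b => \sum_i (G a (Q (std_basis i)) : k) *: (v2r b 0 i : k^o))
  t).
  apply: eq_sw => a b; rewrite {1}(std_basisE b).
  rewrite -[LHS]/(to_linear (lG a) (to_linear lQ _)) !linear_sum.
  by apply: eq_bigr => i _; rewrite !linearZ /=; apply: mulrC.
transitivity (\sum_i sw (fun a b => (G a (Q (std_basis i)) : k) *: (v2r b 0 i : k^o))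
  t).
  by rewrite /sw tlift_sum.
apply: big1 => i _.
have := congr1 (dot (std_basis i)) (G0 (Q (std_basis i))).
rewrite linear0 (linear_sw _ _ (linearP _)) => E; rewrite -[RHS]E.
by apply: eq_sw => a b; rewrite linearZ /= -dot_std.
Qed.

Variable L : H.
Hypothesis L_int : two_sided_integral L.
Let L_l h : h * L = (eps h : k) *: L. Proof. by case: L_int. Qed.
Let L_r h : L * h = (eps h : k) *: L. Proof. by case: L_int. Qed.
Let eps_L : eps L = 1 :> k. Proof. by case: L_int. Qed.

(** Insert S(h_2) h_3: the left side becomes h_1 L_1 \ox S(h_2 L_2) h_3, where Delta(h_1 L) is
    absorbed because [L] is a left integral. *)
Lemma casimir (U : lmodType k) (F : H -> H -> U) h : bilin F ->
  sw (fun a b => F (h * a) (S b)) L = sw (fun a b => F a (S b * h)) L.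
Proof.
move=> bF.
transitivity (sw (fun a b => sw (fun x t => sw (fun y z =>
  F (x * a) (S b * (S y * z))) t) h) L).
  apply: eq_sw => a b.
  by rewrite (@sw_id_antipodel _ _ _ (fun x w => F (x * a) (S b * w))) ?mulr1 //;
    prove_linear.
transitivity (sw (fun t z => sw (fun a b => F a (S b * z)) (t * L)) h).
  rewrite sw_exchange.
  transitivity (sw (fun x t => sw (fun y z => sw (fun a b =>
    F (x * a) (S (y * b) * z)) L) t) h).
    apply: eq_sw => x t; rewrite sw_exchange; apply: eq_sw => y z.
    by apply: eq_sw => a b; rewrite antipodeM mulrA.
  rewrite -(@sw_assoc _ _ _ (fun x y z => sw (fun a b =>
    F (x * a) (S (y * b) * z)) L)); try by prove_linear.
  by apply: eq_sw => t z; rewrite swM //; prove_linear.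
transitivity (sw (fun t z => (eps t : k) *: sw (fun a b => F a (S b * z)) L) h).
  apply: eq_sw => t z; rewrite L_l.
  by rewrite -[LHS]/(to_linear (linear_sw_arg _ (@linear_id _ _)) _) linearZ.
by rewrite (@sw_counitl _ _ _ (fun z => sw (fun a b => F a (S b * z)) L)) //;
  prove_linear.
Qed.

(** Insert h_2 S(h_3) after the second leg and absorb h into [L], now as a right integral. *)
Lemma casimir_op (U : lmodType k) (F : H -> H -> U) h : bilin F ->
  sw (fun a b => F (a * h) b) L = sw (fun a b => F a (b * S h)) L.
Proof.
move=> bF.
transitivity (sw (fun a b => sw (fun x t => sw (fun y z =>
  F (a * x) (b * (y * S z))) t) h) L).
  apply: eq_sw => a b.
  by rewrite (@sw_id_antipoder _ _ _ (fun x w => F (a * x) (b * w))) ?mulr1 //;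
    prove_linear.
transitivity (sw (fun t z => sw (fun a b => F a (b * S z)) (L * t)) h).
  rewrite sw_exchange.
  transitivity (sw (fun x t => sw (fun y z => sw (fun a b =>
    F (a * x) (b * y * S z)) L) t) h).
    apply: eq_sw => x t; rewrite sw_exchange; apply: eq_sw => y z.
    by apply: eq_sw => a b; rewrite mulrA.
  rewrite -(@sw_assoc _ _ _ (fun x y z => sw (fun a b => F (a * x) (b * y * S z)) L));
    try by prove_linear.
  by apply: eq_sw => t z; rewrite swM; [rewrite sw_exchange|prove_linear].
transitivity (sw (fun t z => (eps t : k) *: sw (fun a b => F a (b * S z)) L) h).
  apply: eq_sw => t z; rewrite L_r.
  by rewrite -[LHS]/(to_linear (linear_sw_arg _ (@linear_id _ _)) _) linearZ.
by rewrite (@sw_counitl _ _ _ (fun z => sw (fun a b => F a (b * S z)) L)) //;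
  prove_linear.
Qed.

(* y = L_1 S(L_2) y, and f(L_1 h) L_2 = f(L_1) L_2 S(h) vanishes for every h. *)
Lemma functional_eq0 (f : {linear H -> k^o}) :
  sw (fun a b => (f a : k) *: b) L = 0 -> forall y, f y = 0.
Proof.
move=> f0 y.
have : sw (fun a b => f (a * (S b * y))) L = 0.
  apply: (@slice0 (fun a h => f (a * h)) (fun b => S b * y)); try by prove_linear.
  move=> h; rewrite (@casimir_op _ (fun a b => (f a : k) *: b)); last by prove_linear.
  rewrite -[RHS](mul0r (S h)) -f0 (linear_sw _ _ (linear_mulr (S h) (@linear_id _ _))).
  by apply: eq_sw => a b; rewrite scalerAl.
move=> <-; symmetry.
transitivity (sw (fun a b => f (a * S b * y)) L).
  by apply: eq_sw => a b; rewrite mulrA.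
rewrite (@sw_antipoder _ _ _ (fun x => f (x * y))); last by prove_linear.
by rewrite eps_L scale1r mul1r.
Qed.

End Frobenius.

Section Integrals.
Variables (k : fieldType) (H : hopfAlgType k).
Implicit Types (g h x y : H).
Local Notation eps := (eps H).
Local Notation S := (@antipode k H).
Variable L : H.
Hypothesis L_int : two_sided_integral L.
Let L_l h : h * L = (eps h : k) *: L. Proof. by case: L_int. Qed.
Let L_r h : L * h = (eps h : k) *: L. Proof. by case: L_int. Qed.
Let eps_L : eps L = 1 :> k. Proof. by case: L_int. Qed.

(** The map f -> f(L_1) L_2 from the dual to [H] is injective by [functional_eq0], hence onto by
    equality of dimensions. *)
Lemma sw_dual_surj y :
  exists f : {linear H -> k^o}, sw (fun a b => (f a : k) *: b) L = y.
Proof.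
have lT : linear (fun x => sw (fun a b => (dot x a : k) *: b) L).
  by prove_linear; exact: dot_linearl.
have [x xT|x <-] := @inj_surj _ _ (to_linear lT) _ y; last by exists (dot x).
have x0 := functional_eq0 L_int xT.
by apply: dual_eq => f; have [z fz] := dual_dot f;
  rewrite !fz linear0 -[RHS](x0 z) /= /dot_fun; apply: eq_bigr => i _; rewrite mulrC.
Qed.

Lemma functional_eq (f g : {linear H -> k^o}) :
    sw (fun a b => (f a : k) *: b) L = sw (fun a b => (g a : k) *: b) L ->
  forall y, f y = g y.
Proof.
move=> fg y; apply/eqP; rewrite -subr_eq0; apply/eqP.
have lfg : linear (fun x => f x - g x) by prove_linear.
apply: (functional_eq0 L_int (f := to_linear lfg)) => /=.
transitivity (sw (fun a b => (f a : k) *: b - (g a : k) *: b) L).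
  by apply: eq_sw => a b; rewrite scalerBl.
by rewrite [LHS]tliftB -/(sw _ _) fg subrr.
Qed.

Variable lam : {linear H -> k^o}.
Hypothesis lamL : sw (fun a b => (lam a : k) *: b) L = 1.

(** Test with a functional f and compare two functionals of h by [functional_eq]: lam(L_1) f(L_2)
    L_3 and lam(L_1) f(1) L_2 are both f(1) 1, because lam(L_1) L_2 = 1 and 1 is grouplike. *)
Lemma lam_integral_r h : sw (fun a b => (lam a : k) *: b) h = (lam h : k) *: 1.
Proof.
apply: dual_eq => f; rewrite (linear_sw _ _ (linearP f)) linearZ /=.
have lF : linear (fun h => sw (fun a b => f ((lam a : k) *: b)) h) by prove_linear.
have lG : linear (fun h => (lam h : k) *: f 1) by prove_linear.
apply: (@functional_eq (to_linear lF) (to_linear lG)) => /=.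
transitivity ((f 1 : k) *: (1 : H)).
  transitivity (sw (fun a b => (f a : k) *: b) (1 : H)); last by rewrite sw1 //;
    prove_linear.
  rewrite -lamL [RHS](linear_sw _ _ (linear_sw_arg _ (@linear_id _ _))).
  transitivity (sw (fun a b => sw (fun c d => (lam a : k) *: ((f c : k) *: d)) b) L).
    rewrite -(@sw_assoc _ _ _ (fun a c d => (lam a : k) *: ((f c : k) *: d)));
      try by prove_linear.
    apply: eq_sw => a d; rewrite (linear_sw _ _ (linear_scalel d (@linear_id _ _))).
    by apply: eq_sw => c e; rewrite linearZ /= scalerA.
  apply: eq_sw => a b.
  by rewrite -[RHS]/(to_linear (linear_sw_arg _ (@linear_id _ _)) _) linearZ /=
    (linear_sw _ _ (linear_scaler _ (@linear_id _ _))).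
rewrite -[X in _ *: X = _]lamL (linear_sw _ _ (linear_scaler _ (@linear_id _ _))).
by apply: eq_sw => a b; rewrite scalerA [X in X *: _ = _]mulrC.
Qed.

(** L_1 and S(L_2) are dual bases for the form lam(x y): [casimir] moves h to the right, where
    lam(L_1) S(L_2) = S(1) is left. *)
Lemma lam_casimir h : sw (fun a b => (lam (h * a) : k) *: S b) L = h.
Proof.
rewrite (@casimir _ _ _ L_int _ (fun a b => (lam a : k) *: b)); last by prove_linear.
rewrite -[RHS]mul1r -antipode1 -[X in _ = S X * _]lamL.
rewrite (linear_sw _ _ (linearP S)) (linear_sw _ _ (linear_mulr h (@linear_id _ _))).
by apply: eq_sw => a b; rewrite linearZ /= scalerAl.
Qed.

Lemma lam_casimir_op h : sw (fun a b => (lam (a * h) : k) *: b) L = S h.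
Proof.
rewrite (@casimir_op _ _ _ L_int _ (fun a b => (lam a : k) *: b)); last by prove_linear.
rewrite -[RHS]mul1r -lamL (linear_sw _ _ (linear_mulr (S h) (@linear_id _ _))).
by apply: eq_sw => a b; rewrite scalerAl.
Qed.

Lemma antipode_surj y : exists x, S x = y.
Proof.
exists (sw (fun a b => (lam (y * a) : k) *: b) L).
rewrite (linear_sw _ _ (linearP S)) -[RHS]lam_casimir.
by apply: eq_sw => a b; rewrite linearZ.
Qed.

Lemma antipode_eq0 x : S x = 0 -> x = 0.
Proof. exact: surj_inj antipode_surj _. Qed.

Lemma antipode_inj : injective S.
Proof.
by move=> x y Sxy; apply/eqP; rewrite -subr_eq0; apply/eqP/antipode_eq0;
  rewrite linearB /= Sxy subrr.
Qed.

Lemma lam_nondegl h : (forall x, lam (h * x) = 0) -> h = 0.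
Proof.
move=> h0; rewrite -(lam_casimir h) /sw -[RHS](@tlift0 _ _ _ _ (comul L)).
by apply: eq_tlift => a b; rewrite h0 scale0r.
Qed.

(** By [functional_eq] both sides may be contracted with [L]. The right one gives S(y) by
    [lam_casimir_op]; after applying the injective S, the left one gives S(S(y)) by
    [lam_casimir]. *)
Lemma nakayama x y : lam (S (S y) * x) = lam (x * y).
Proof.
have lF : linear (fun x => lam (S (S y) * x)) by prove_linear.
have lG : linear (fun x => lam (x * y)) by prove_linear.
apply: (@functional_eq (to_linear lF) (to_linear lG)) => /=.
rewrite lam_casimir_op; apply: antipode_inj.
rewrite (linear_sw _ _ (linearP S)) -[RHS]lam_casimir.
by apply: eq_sw => a b; rewrite linearZ.
Qed.

Lemma lam_L : lam L = 1 :> k.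
Proof.
have E : lam (sw (fun a b => (eps b : k) *: a) L) = eps (sw (fun a b =>
  (lam a : k) *: b) L).
  rewrite (linear_sw _ _ (linearP lam)) (linear_sw _ _ (linearP eps)).
  by apply: eq_sw => a b; rewrite !linearZ /= [RHS]mulrC.
by rewrite -(@eps1 k H) -lamL -E (@sw_counitr _ _ _ id).
Qed.

(** The distinguished grouplike element: by [lam_integral_l] it measures how far the right integral
    [lam] is from being a left one. *)
Definition distinguished := sw (fun a b => (lam b : k) *: a) L.
Local Notation a0 := distinguished.

Lemma lam_integral_l h : sw (fun a b => (lam b : k) *: a) h = (lam h : k) *: a0.
Proof.
apply: dual_eq => f; rewrite (linear_sw _ _ (linearP f)) linearZ /=.
have lF : linear (fun h => sw (fun a b => f ((lam b : k) *: a)) h) by prove_linear.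
have lG : linear (fun h => (lam h : k) *: f a0) by prove_linear.
apply: (@functional_eq (to_linear lF) (to_linear lG)) => /=.
transitivity ((f a0 : k) *: (1 : H)); last first.
  rewrite -[X in _ *: X = _]lamL (linear_sw _ _ (linear_scaler _ (@linear_id _ _))).
  by apply: eq_sw => a b; rewrite scalerA; rewrite [X in X *: _ = _]mulrC.
transitivity (sw (fun x c => sw (fun a b => ((f a : k) * lam b) *: c) x) L).
  apply: eq_sw => x c; rewrite (linear_sw _ _ (linear_scalel c (@linear_id _ _))).
  by apply: eq_sw => a b; rewrite linearZ /= [_ * _]mulrC.
rewrite (@sw_assoc _ _ _ (fun a b c => ((f a : k) * lam b) *: c)); last first.
- by prove_linear.
- by move=> a c; apply: linear_scalel; move=> ? ? ?; rewrite linearP mulrDr scalerAr.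
- by move=> b c; apply: linear_scalel; move=> ? ? ?; rewrite linearP mulrDl scalerAl.
transitivity (sw (fun a x => ((f a : k) * lam x) *: (1 : H)) L).
  apply: eq_sw => a x; rewrite -scalerA -lam_integral_r (linear_sw _ _ (linear_scaler _
    (@linear_id _ _))).
  by apply: eq_sw => b c; rewrite scalerA.
rewrite /distinguished (linear_sw _ _ (linearP f)).
have l1 : linear (fun c : k^o => (c : k) *: (1 : H)) by move=> u c d;
  rewrite scalerDl -scalerA.
rewrite -[RHS]/((fun c : k^o => (c : k) *: (1 : H)) _) [RHS](linear_sw _ _ l1).
by apply: eq_sw => b c; rewrite linearZ /= [_ * _]mulrC.
Qed.

(** By coassociativity the coproduct is L_1 \ox lam(L_3) L_2, and [lam_integral_l] turns this into
    L_1 \ox lam(L_2) a0. *)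
Lemma sw_distinguished (U : lmodType k) (F : H -> H -> U) : bilin F ->
  sw F a0 = F a0 a0.
Proof.
move=> bF; rewrite (linear_sw _ _ (linear_sw_arg _ (@linear_id _ _))).
transitivity (sw (fun x c => sw (fun a b => (lam c : k) *: F a b) x) L).
  apply: eq_sw => x c; rewrite -[LHS]/(to_linear (linear_sw_arg _ (@linear_id _ _)) _)
    linearZ /=.
  by rewrite (linear_sw _ _ (linear_scaler _ (@linear_id _ _))).
rewrite (@sw_assoc _ _ _ (fun a b c => (lam c : k) *: F a b)); try by prove_linear.
transitivity (sw (fun a x => F a ((lam x : k) *: a0)) L).
  apply: eq_sw => a x; rewrite -lam_integral_l.
  have lFa : linear (F a) by prove_linear.
  rewrite (linear_sw _ _ lFa); apply: eq_sw => b c.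
  by rewrite -[RHS]/(to_linear lFa _) linearZ.
have lFa : linear (F^~ a0) by prove_linear.
rewrite -[RHS]/((fun x => F x a0) a0) [in RHS]/a0 [RHS](linear_sw _ _ lFa).
apply: eq_sw => b c; have lFb : linear (F b) by prove_linear.
by rewrite -[RHS]/(to_linear lFa _) linearZ /= -[LHS]/(to_linear lFb _) linearZ.
Qed.

Lemma eps_distinguished : eps a0 = 1 :> k.
Proof.
have E : lam (sw (fun a b => (eps a : k) *: b) L) = eps a0.
  rewrite /distinguished (linear_sw _ _ (linearP lam)) (linear_sw _ _ (linearP eps)).
  by apply: eq_sw => a b; rewrite !linearZ /= [RHS]mulrC.
by rewrite -E (@sw_counitl _ _ _ id) ?lam_L.
Qed.

Lemma antipode_distinguished_l : S a0 * a0 = 1.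
Proof.
have := @sw_antipodel _ _ _ id a0 (@linear_id _ _).
by rewrite eps_distinguished scale1r sw_distinguished //; prove_linear.
Qed.

Lemma antipode_distinguished_r : a0 * S a0 = 1.
Proof.
have := @sw_antipoder _ _ _ id a0 (@linear_id _ _).
by rewrite eps_distinguished scale1r sw_distinguished //; prove_linear.
Qed.

Lemma antipode2_distinguished : S (S a0) = a0.
Proof.
have SS : S (S a0) * S a0 = 1 by rewrite -antipodeM antipode_distinguished_r antipode1.
by rewrite -[LHS]mulr1 -antipode_distinguished_l mulrA SS mul1r.
Qed.

(** Since x has the form g(L_1) L_2, it suffices to compare lam(S(L_2)) L_1 with lam(L_2 a0) L_1;
    both are 1. *)
Lemma lam_antipode x : lam (S x) = lam (x * a0).
Proof.
pose f x := lam (S x) - lam (x * a0).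
have lf : linear f by rewrite /f; prove_linear.
have lfL : sw (fun a b => (f b : k) *: a) L = 0.
  have f1 : sw (fun a b => (lam (S b) : k) *: a) L = 1.
    apply: antipode_inj; rewrite antipode1 (linear_sw _ _ (linearP S)).
    have := lam_integral_r (S L); rewrite sw_antipode; last by prove_linear.
    (* With L = S(z), the product S(L) L is L by the left integral property, and it is S(z L) = S(L)
       as well. *)
    have SL : S L = L.
      have [z zL] := antipode_surj L.
      have E1 : S L * L = L by rewrite L_l eps_antipode eps_L scale1r.
      have eps_z : eps z = 1 :> k by rewrite -eps_antipode zL.
      by rewrite -[RHS]E1 -[X in _ * X]zL -antipodeM L_l eps_z scale1r.
    rewrite SL lam_L scale1r => <-.
    by apply: eq_sw => a b; rewrite linearZ.
  (* Apply [lam_integral_l] to L a0 = L and cancel the invertible a0. *)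
  have f2 : sw (fun a b => (lam (b * a0) : k) *: a) L = 1.
    have := lam_integral_l (L * a0); rewrite swM; last by prove_linear.
    rewrite L_r eps_distinguished scale1r lam_L scale1r => E.
    have := congr1 (fun x => x * S a0) E; rewrite antipode_distinguished_r => <-.
    rewrite (linear_sw _ _ (linear_mulr _ (@linear_id _ _))).
    apply: eq_sw => a b; rewrite sw_distinguished; last by prove_linear.
    by rewrite -scalerAl -mulrA antipode_distinguished_r mulr1.
  transitivity (sw (fun a b => (lam (S b) : k) *: a - (lam (b * a0) : k) *: a) L).
    by apply: eq_sw => a b; rewrite scalerBl.
  by rewrite [LHS]tliftB [X in X - _]f1 [X in _ - X]f2 subrr.
apply/eqP; rewrite -subr_eq0 -/(f x); apply/eqP.
have [g gx] := sw_dual_surj x; rewrite -gx (linear_sw _ _ lf).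
have := congr1 g lfL; rewrite linear0 (linear_sw _ _ (linearP g)) => <-.
apply: eq_sw => a b; rewrite linearZ /= -[LHS]/(to_linear lf _) linearZ.
exact: mulrC.
Qed.

(** Radford's formula for S^4 in the unimodular case. By [nakayama] lam(S(x y)) = lam(S(y S^2(x)));
    [lam_antipode] removes the outer S, and [nakayama] again brings a0 and S^2(x) to the front. Then
    use nondegeneracy in y. *)
Lemma antipode4 x : a0 * x = S (S (S (S x))) * a0.
Proof.
apply/eqP; rewrite -subr_eq0; apply/eqP; apply: lam_nondegl => y.
rewrite mulrBl linearB /=; apply/eqP; rewrite subr_eq0; apply/eqP.
have E : lam (S (x * y)) = lam (S (y * S (S x))).
  by rewrite !antipodeM -nakayama.
move: E; rewrite !lam_antipode -nakayama antipode2_distinguished -mulrA => E.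
rewrite -[LHS]/(lam _) -mulrA E -mulrA -nakayama antipodeM antipodeM
  antipode2_distinguished.
by rewrite mulrA.
Qed.

End Integrals.

(** * Grouplike elements *)

Section Grouplike.
Variables (k : fieldType) (H : hopfAlgType k).

Definition grouplike (g : H) : Prop := comul g = g \ox g /\ g <> 0.

Lemma comul_sw (h : H) : comul h = sw (fun a b => a \ox b) h.
Proof. exact: tensor_std_sum. Qed.

Lemma sw_grouplike (U : lmodType k) (F : H -> H -> U) g :
  bilin F -> grouplike g -> sw F g = F g g.
Proof. by move=> bF [gg _]; rewrite /sw gg tliftE. Qed.

(** If x is a combination of independent grouplikes with coefficients c_i, applying two coordinate
    forms to its coproduct gives c_i c_j = 0 for distinct i, j and c_i^2 = c_i. So x is one of
    them. *)
Lemma grouplike_free (s : seq H) :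
  (forall g, g \in s -> grouplike g) -> uniq s -> free s.
Proof.
elim: s => [|x s IHs] gs /=; first by rewrite nil_free.
case/andP=> xs us; have fs : free s.
  by apply: IHs => // g sg; apply: gs; rewrite inE sg orbT.
have fs' : free (in_tuple s) := fs; rewrite free_cons fs andbT; apply/negP => xS.
have gx : grouplike x by apply: gs; rewrite mem_head.
have gI (i : 'I_(size s)) : grouplike s`_i by apply: gs; rewrite inE mem_nth ?orbT.
pose c i : k := coord (in_tuple s) i x.
have xE : x = \sum_i c i *: s`_i by exact: (@coord_span _ _ _ (in_tuple s)).
have lc i : linear (coord (in_tuple s) i : H -> k^o) by move=> a u v; rewrite linearP.
have cc i j : c i * c j = if i == j then c i else 0.
  have bF : bilin (fun a b => (coord (in_tuple s) i a : k) *: (coord (in_tuple s) j b :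
    k^o)).
    split=> [v|w]; last by apply: linear_scalel; exact: lc.
    by apply: linear_scaler; exact: lc.
  have := sw_grouplike bF gx; rewrite {1}xE.
  rewrite -[LHS]/(to_linear (linear_sw_arg _ (@linear_id _ _)) _) linear_sum.
  rewrite (eq_bigr (fun l => c l * ((l == i)%:R * (l == j)%:R))) => [E|l _].
    rewrite -[LHS]E (bigD1 i) //= eqxx mul1r big1 ?addr0 => [|l li].
      by case: eqP; rewrite ?mulr1 ?mulr0.
    by rewrite (negPf li) mul0r mulr0.
  by rewrite linearZ /= (sw_grouplike bF (gI l)) (coord_free l i fs') (coord_free l j fs').
have [i ci|c0] := pickP (fun i => c i != 0); last first.
  case: gx => _; apply; rewrite xE big1 // => i _.
  by have /negbFE/eqP-> := c0 i; rewrite scale0r.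
have ci1 : c i = 1 by apply: (mulfI ci); rewrite mulr1 cc eqxx.
move: xs; rewrite xE (bigD1 i) //= ci1 scale1r big1 ?addr0 ?mem_nth // => j ji.
by have := cc i j; rewrite ci1 mul1r eq_sym (negPf ji) => ->; rewrite scale0r.
Qed.

Lemma grouplikeM (g h : H) : grouplike g -> grouplike h -> g * h <> 0 ->
  grouplike (g * h).
Proof.
move=> gg gh gh0; split=> //; rewrite comul_sw swM; last by prove_linear.
rewrite sw_grouplike //; last by prove_linear.
by rewrite sw_grouplike //; prove_linear.
Qed.

(** All powers of g are grouplike, so more than dim [H] of them cannot be distinct; a coincidence is
    cancelled with g'. *)
Lemma grouplike_order (g g' : H) : grouplike g -> g * g' = 1 ->
  exists2 m, (0 < m)%N & g ^+ m = 1.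
Proof.
move=> gg gg'.
have Xinv i : g ^+ i * g' ^+ i = 1.
  by elim: i => [|i IHi]; rewrite ?mulr1 // exprSr exprS mulrA -(mulrA _ g) gg' mulr1.
have Xn0 i : g ^+ i <> 0.
  by move=> g0; have := Xinv i; rewrite g0 mul0r => /esym/eqP; rewrite oner_eq0.
have gX i : grouplike (g ^+ i).
  elim: i => [|i IHi]; last by rewrite exprS; apply: grouplikeM => //; rewrite -exprS.
  by split=> //; rewrite comul1.
pose s := mkseq (fun i => g ^+ i) (\dim {:H}).+1.
have /negP us : ~ uniq s.
  move/(grouplike_free _) => fs; have /fs : forall h, h \in s -> grouplike h.
    by move=> h /mapP[i _ ->].
  rewrite /free size_mkseq => /eqP E.
  by have := dimvS (subvf <<s>>%VS); rewrite E ltnn.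
have [i [j [ij jN gij]]] : exists i j, [/\ (i < j)%N, (j < (\dim {:H}).+1)%N & g ^+ i
  = g ^+ j].
  have /(uniqPn 0)[i [j [ij jN eqij]]] := us; exists i, j.
  by move: jN eqij; rewrite size_mkseq => jN; rewrite !nth_mkseq // (ltn_trans ij).
exists (j - i)%N; first by rewrite subn_gt0.
by rewrite -[LHS]mulr1 -(Xinv i) mulrA -exprD subnK ?(ltnW ij) // gij.
Qed.

End Grouplike.

(** * Traces and blocks *)

Section MatrixTrace.
Variable k : fieldType.

(** In a full rank factorization A = C R, idempotence gives R C = 1, and the trace of R C is the
    rank. *)
Lemma idempotent_trace n (A : 'M[k]_n) : A *m A = A -> \tr A = (\rank A)%:R.
Proof.
move=> AA; move: (mulmx_base A) (row_base_free A) (col_base_full A).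
move: (col_base A) (row_base A) => C R CR freeR fullC.
have /(row_free_inj freeR)/(row_full_inj fullC) E : C *m (R *m C) *m R = C *m 1%:M *m R.
  by rewrite mulmx1 !mulmxA CR -mulmxA CR AA.
by rewrite -[in LHS]CR mxtrace_mulC E mxtrace1.
Qed.

End MatrixTrace.

Section Trace.
Variables (k : fieldType) (H : hopfAlgType k).
Implicit Types (x y z : H) (f g : {linear H -> H}).

Definition lin_mx f : 'M[k]_(dim H) := \matrix_(i, j) v2r (f (std_basis i)) 0 j.
Definition lin_trace f : k := \tr (lin_mx f).

Lemma lin_mxE f x : v2r (f x) = v2r x *m lin_mx f.
Proof.
rewrite {1}(std_basisE x) !linear_sum; apply/rowP => j; rewrite summxE !mxE.
by apply: eq_bigr => i _; rewrite !linearZ !mxE.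
Qed.

Lemma lin_mx_inj f g : lin_mx f = lin_mx g -> f =1 g.
Proof. by move=> fg x; apply: v2r_inj; rewrite !lin_mxE fg. Qed.

Lemma eq_lin_mx f g : f =1 g -> lin_mx f = lin_mx g.
Proof. by move=> fg; apply/matrixP => i j; rewrite !mxE fg. Qed.

Lemma lin_mx_comp f g (h : {linear H -> H}) : h =1 f \o g ->
  lin_mx h = lin_mx g *m lin_mx f.
Proof.
move=> hE; apply/row_matrixP => i.
have rowE (l : {linear H -> H}) : row i (lin_mx l) = v2r (l (std_basis i)).
  by apply/rowP => j; rewrite !mxE.
by rewrite row_mul !rowE hE /= lin_mxE.
Qed.

Definition lmul x : {linear H -> H} := to_linear (linear_mull x (@linear_id _ H)).
Definition lmul_mx x := lin_mx (lmul x).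

Lemma lmul_mx_inj x y : lmul_mx x = lmul_mx y -> x = y.
Proof. by move/lin_mx_inj/(_ 1); rewrite /= !mulr1. Qed.

Lemma lmul_mx_linear : linear lmul_mx.
Proof.
move=> a x y; apply/matrixP => i j; rewrite !mxE /= mulrDl -scalerAl linearP.
by rewrite !mxE.
Qed.

Lemma lmul_mxM x y : lmul_mx (x * y) = lmul_mx y *m lmul_mx x.
Proof. by apply: lin_mx_comp => z; rewrite /= mulrA. Qed.

Lemma lmul_mx1 : lmul_mx 1 = 1%:M.
Proof.
apply/row_matrixP => i; apply/rowP => j.
by rewrite !mxE /= mul1r r2vK mxE eqxx eq_sym.
Qed.

Definition chi_fun x : k^o := \tr (lmul_mx x).
Lemma chi_linear : linear chi_fun.
Proof. by move=> a x y; rewrite /chi_fun lmul_mx_linear linearP. Qed.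
Definition chi : {linear H -> k^o} := to_linear chi_linear.

Lemma chiE x : chi x = \tr (lmul_mx x). Proof. by []. Qed.

Lemma chiC x y : chi (x * y) = chi (y * x).
Proof. by rewrite !chiE !lmul_mxM mxtrace_mulC. Qed.

Definition central (x : H) := forall y, x * y = y * x.
Definition idempotent_elt (e : H) := e * e = e.

Lemma chi_idempotent e : idempotent_elt e -> chi e = (\rank (lmul_mx e))%:R :> k.
Proof. by move=> ee; rewrite chiE idempotent_trace // -lmul_mxM ee. Qed.

Lemma rank_lmul_mx_eq0 e : \rank (lmul_mx e) = 0%N -> e = 0.
Proof.
move/eqP; rewrite mxrank_eq0 => /eqP e0; apply: lmul_mx_inj; rewrite e0.
by rewrite -[lmul_mx 0]/(to_linear lmul_mx_linear 0) linear0.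
Qed.

End Trace.

Section SemisimpleTrace.
Variables (k : fieldType) (H : hopfAlgType k).
Hypotheses (k_char0 : [pchar k] =i pred0) (H_ss : semisimple_alg H).
Implicit Types (x y z : H).
Local Notation chi := (@chi k H).

Lemma natr_eq0 n : n%:R = 0 :> k -> n = 0%N.
Proof. by move/eqP; rewrite ((pcharf0P k).1 k_char0) => /eqP. Qed.

Lemma chi_idempotent_eq0 e : idempotent_elt e -> chi e = 0 -> e = 0.
Proof. by move=> ee; rewrite chi_idempotent // => /natr_eq0/rank_lmul_mx_eq0. Qed.

(** The map sending x to the functional chi(- x), encoded by its values on the standard basis as an
    element of [H], so that [inj_surj] applies. *)
Lemma chi_vec_linear : linear (fun x => r2v (\row_i (chi (std_basis i * x) : k)) : H).
Proof.
move=> a x y; apply: v2r_inj; rewrite linearP /= !r2vK; apply/rowP => i.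
by rewrite !mxE mulrDr -scalerAr; exact: chi_linear.
Qed.

Lemma chi_vec0 x : (r2v (\row_i (chi (std_basis i * x) : k)) : H) = 0 <->
  forall y, chi (x * y) = 0.
Proof.
split=> [x0 y|x0]; last first.
  by apply: v2r_inj; rewrite linear0 r2vK; apply/rowP => i; rewrite !mxE chiC x0.
rewrite chiC {1}(std_basisE y) mulr_suml linear_sum big1 // => i _.
have := congr1 (fun y => v2r y 0 i) x0; rewrite r2vK linear0 !mxE => xi.
by rewrite -scalerAl linearZ /= [chi_fun _]xi scaler0.
Qed.

(* The radical of the trace form is a left ideal H e with e idempotent, and
   chi e is the rank of e. *)
Lemma chi_nondeg x : (forall y, chi (x * y) = 0) -> x = 0.
Proof.
pose J := lker (linfun (to_linear chi_vec_linear)).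
have memJ z : z \in J <-> forall y, chi (z * y) = 0.
  by rewrite -chi_vec0 memv_ker lfunE /=; split=> [/eqP|->].
have lJ : left_ideal J.
  by move=> h z /memJ zJ; apply/memJ => y; rewrite -mulrA chiC -mulrA.
have [e eJ eE] := left_ideal_idempotent H_ss lJ.
move=> /memJ xJ; rewrite -(eE x xJ) (@chi_idempotent_eq0 e) ?mulr0 //; first exact: eE.
by have /memJ/(_ 1) := eJ; rewrite mulr1.
Qed.

Lemma chi_rep (f : {linear H -> k^o}) : exists u, forall x, f x = chi (x * u).
Proof.
have [|u uE] := @inj_surj _ _ (to_linear chi_vec_linear) _ (r2v (\row_i (f (std_basis
  i) : k))).
  by move=> x /chi_vec0/chi_nondeg.
exists u => x; rewrite {1 2}(std_basisE x) mulr_suml !linear_sum; apply: eq_bigr => i _.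
have := congr1 (fun y => v2r y 0 i) uE; rewrite /= !r2vK !mxE => xi.
by rewrite -scalerAl linearZ -[chi_fun _]/(chi _) linearZ -xi.
Qed.

End SemisimpleTrace.

Section Blocks.
Variables (k : closedFieldType) (H : hopfAlgType k).
Hypotheses (k_char0 : [pchar k] =i pred0) (H_ss : semisimple_alg H).
Implicit Types (x y z : H).
Local Notation chi := (@chi k H).

(** A primitive central idempotent; primitivity is expressed by the center acting on z [H] through
    scalars. *)
Definition block z := [/\ central z, idempotent_elt z, z <> 0 &
  forall x, central x -> exists c : k, x * z = c *: z].

Lemma annihilating_poly x : exists2 p : {poly k}, p != 0 & horner_alg x p = 0.
Proof.
(* One power of x more than the dimension: the rows are dependent. *)
pose A : 'M[k]_((dim H).+1, dim H) := \matrix_(i, j) v2r (x ^+ i) 0 j.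
have /rowV0Pn[c cA c0] : kermx A != 0.
  by rewrite -mxrank_eq0 mxrank_ker subn_eq0 -ltnNge ltnS rank_leq_col.
exists (rVpoly c).
  by apply: contraNneq c0 => c0; rewrite -(rVpolyK c) c0 linear0.
apply: v2r_inj; rewrite linear0 -(sub_kermxP cA) /rVpoly poly_def !linear_sum /=.
apply/rowP => j; rewrite summxE mxE; apply: eq_bigr => i _.
rewrite -mul_polyC rmorphM /= horner_algC rmorphXn /= horner_algX.
by rewrite insubT // => ltj; rewrite -scalerAl mul1r linearZ !mxE; congr (c _ _ * _);
  apply: val_inj.
Qed.

Lemma eigenvector_prod x (rs : seq k) y :
    \prod_(a <- rs) (x - a%:A) * y = 0 -> y <> 0 ->
  exists a c, c * y <> 0 /\ (x - a%:A) * (c * y) = 0.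
Proof.
elim: rs => [|a rs IHrs]; first by rewrite big_nil mul1r.
rewrite big_cons -mulrA => xy0 y0.
case: (eqVneq (\prod_(a <- rs) (x - a%:A) * y) 0) => [/IHrs|/eqP nz]; first exact.
by exists a, (\prod_(a <- rs) (x - a%:A)).
Qed.

(** Split an annihilating polynomial of x into linear factors and apply them to y one at a time; the
    last nonzero vector is an eigenvector, and it is a left multiple of y. *)
Lemma eigenvector x y : y <> 0 ->
  exists a c, c * y <> 0 /\ (x - a%:A) * (c * y) = 0.
Proof.
move=> y0; have [p p0 px0] := annihilating_poly x.
have [rs pE] := closed_field_poly_normal p.
apply: (@eigenvector_prod x rs) => //.
have : (lead_coef p) *: \prod_(a <- rs) (x - a%:A) = 0.
  rewrite -px0 [in RHS]pE linearZ /= rmorph_prod mulr_algl; congr (_ *: _).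
  by apply: eq_bigr => a _; rewrite rmorphB /= horner_algX horner_algC.
move/eqP; rewrite scaler_eq0 lead_coef_eq0 (negPf p0) /= => /eqP->.
by rewrite mul0r.
Qed.

(* The eigenspaces of x in z H are two-sided ideals of the form H e; the
   idempotent e is central because e H (1 - e) = 0 and chi is nondegenerate. *)
Lemma central_split x z : central x -> central z -> idempotent_elt z ->
    ~ (exists c : k, x * z = c *: z) ->
  exists e, [/\ central e, idempotent_elt e, z * e = e, e <> 0 & e <> z].
Proof.
move=> cx cz zz xz.
have z0 : z <> 0.
  by move=> z0; apply: xz; exists 0; rewrite z0 mulr0 scaler0.
have [a [c [cz0 acz]]] := eigenvector x z0.
pose I := (lker (linfun (lmul (z - 1))) :&: lker (linfun (lmul (x - a%:A))))%VS.
have memI y : y \in I <-> z * y = y /\ x * y = a *: y.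
  rewrite memv_cap !memv_ker !lfunE /= !mulrBl mul1r -scalerAl mul1r !subr_eq0.
  by split=> [/andP[/eqP? /eqP?]|[-> ->]] //; rewrite !eqxx.
have lI : left_ideal I.
  move=> h y /memI[zy xy]; apply/memI.
  by rewrite !mulrA cz cx -!mulrA zy xy scalerAr.
have rI y h : y \in I -> y * h \in I.
  by move=> /memI[zy xy]; apply/memI; rewrite !mulrA zy xy scalerAl.
have czI : c * z \in I.
  apply/memI; split; first by rewrite mulrA cz -mulrA zz.
  by apply/eqP; rewrite -subr_eq0 -[a *: _]mul1r -scalerAr scalerAl -mulrBl acz.
have [e eI eE] := left_ideal_idempotent H_ss lI.
have [ze xe] := (memI e).1 eI.
have ehe h : e * h * e = e * h by apply/eE/rI.
exists e; split=> //.
- move=> h; apply/eqP; rewrite -subr_eq0; apply/eqP/chi_nondeg => // y.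
  have E : chi (e * h * y) = chi (h * e * y) by
    rewrite -[h * e * y]mulrA [RHS]chiC -[e * y]ehe -[e * y * e * h]mulrA [RHS]chiC
      mulrA ehe.
  by rewrite mulrBl linearB; apply/eqP; rewrite subr_eq0; exact/eqP/E.
- exact: eE.
- by move=> e0; apply: cz0; rewrite -(eE _ czI) e0 mulr0.
- by move=> ez; apply: xz; exists a; rewrite -ez.
Qed.

End Blocks.

Section BlockDecomposition.
Variables (k : closedFieldType) (H : hopfAlgType k).
Hypotheses (k_char0 : [pchar k] =i pred0) (H_ss : semisimple_alg H).
Implicit Types (x y z : H).
Local Notation chi := (@chi k H).
Local Notation eps := (eps H).
Local Notation S := (@antipode k H).

Lemma natr_inj m n : m%:R = n%:R :> k -> m = n.
Proof.
wlog mn : m n / (m <= n)%N => [hw E|].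
  by case/orP: (leq_total m n) => [/hw->|/hw->].
move=> E; apply/eqP; rewrite eqn_leq mn -subn_eq0 /=; apply/eqP/(natr_eq0 k_char0).
by rewrite natrB // E subrr.
Qed.

(** Induction on the rank of z. If some central x does not act on z by a scalar, [central_split]
    gives z = e + f, and the ranks add up since in characteristic 0 they are read off from chi. *)
Lemma block_split n z : central z -> idempotent_elt z -> (\rank (lmul_mx z) <= n)%N ->
  exists2 s : seq H, forall x, x \in s -> block x & \sum_(x <- s) x = z.
Proof.
elim: n z => [|n IHn] z cz zz rz.
  exists [::]; rewrite ?big_nil //; apply/esym/rank_lmul_mx_eq0/eqP.
  by rewrite -leqn0.
have [z0|z0] := eqVneq z 0; first by exists [::]; rewrite ?big_nil.
have [[x [cx xz]]|nx] := EM (exists x, central x /\ ~ exists c : k, x * z = c *: z);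
  last first.
  exists [:: z]; rewrite ?big_seq1 // => y; rewrite inE => /eqP->.
  split=> //; first exact/eqP.
  by move=> x cx; apply: contrapT => xz; apply: nx; exists x.
have [e [ce ee ze e0 ez]] := central_split k_char0 H_ss cx cz zz xz.
have ez' : e * z = e by rewrite ce.
pose f := z - e.
have cf : central f by move=> y; rewrite /f mulrBl mulrBr cz ce.
have ff : idempotent_elt f.
  by rewrite /idempotent_elt /f mulrBl !mulrBr zz ze ez' ee subrr subr0.
have rE : \rank (lmul_mx z) = (\rank (lmul_mx e) + \rank (lmul_mx f))%N.
  apply: natr_inj; rewrite natrD -!chi_idempotent //.
  by rewrite -[RHS](linearD chi) addrC /f subrK.
have re : (0 < \rank (lmul_mx e))%N by rewrite lt0n; apply/eqP => /rank_lmul_mx_eq0.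
have rf : (0 < \rank (lmul_mx f))%N.
  rewrite lt0n; apply/eqP => /rank_lmul_mx_eq0 /eqP; rewrite subr_eq0 => /eqP/esym.
  exact: ez.
have [|s sb sE] := IHn e ce ee.
  by rewrite -ltnS (leq_trans _ rz) // rE -addn1 leq_add2l.
have [|t tb tE] := IHn _ cf ff.
  by rewrite -ltnS (leq_trans _ rz) // rE -add1n leq_add2r.
exists (s ++ t); last by rewrite big_cat /= sE tE addrC /f subrK.
by move=> y; rewrite mem_cat => /orP[/sb|/tb].
Qed.

Lemma blocks_exist :
  exists2 s : seq H, forall x, x \in s -> block x & \sum_(x <- s) x = 1.
Proof.
have c1 : central (1 : H) by move=> x; rewrite mulr1 mul1r.
have i1 : idempotent_elt (1 : H) by rewrite /idempotent_elt mulr1.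
exact: (block_split c1 i1 (leqnn _)).
Qed.

Lemma block_chi z : block z -> exists2 n, (0 < n)%N & chi z = n%:R :> k.
Proof.
case=> _ zz z0 _; exists (\rank (lmul_mx z)); last exact: chi_idempotent.
by rewrite lt0n; apply/eqP => /rank_lmul_mx_eq0.
Qed.

Variable L : H.
Hypothesis L_int : two_sided_integral L.
Let L_l h : h * L = (eps h : k) *: L. Proof. by case: L_int. Qed.
Let L_r h : L * h = (eps h : k) *: L. Proof. by case: L_int. Qed.
Let eps_L : eps L = 1 :> k. Proof. by case: L_int. Qed.

(** Some block z has eps(z) nonzero, as eps(1) = 1. Then L z is both eps(z) L and a multiple of z,
    so z and [L] are proportional idempotents, hence equal. *)
Lemma integral_block s : (forall x, x \in s -> block x) ->
  \sum_(x <- s) x = 1 -> L \in s.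
Proof.
move=> sb s1.
have [z zs ez] : exists2 z, z \in s & eps z != 0.
  apply: contrapT => nz; have : eps 1 = 0.
    rewrite -s1 linear_sum big_seq big1 // => z zs.
    by apply/eqP/negPn/negP => ez; apply: nz; exists z.
  by move/eqP; rewrite eps1 oner_eq0.
have [cz zz z0 zc] := sb z zs.
have cL : central L by move=> x; rewrite L_l L_r.
have [c Lz] := zc L cL.
have E : c *: z = (eps z : k) *: L by rewrite -Lz L_r.
have L0 : L != 0.
  by apply/eqP => L0; move: eps_L; rewrite L0 linear0 => /esym/eqP; rewrite oner_eq0.
have c0 : c != 0.
  by apply: contraNneq L0 => c0; move/eqP: E;
    rewrite c0 scale0r eq_sym scaler_eq0 (negPf ez) => /eqP->.
pose d := c^-1 * eps z.
have zE : z = d *: L by rewrite -scalerA -E scalerA mulVf // scale1r.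
have LL : L * L = L by rewrite L_l eps_L scale1r.
have dd : (d * d - d) *: L = 0.
  move: zz; rewrite /idempotent_elt {1 2 3}zE -scalerAl -scalerAr LL scalerA => zz.
  by rewrite scalerBl zz subrr.
move/eqP: dd; rewrite scaler_eq0 (negPf L0) orbF -{3}[d]mulr1 -mulrBr mulf_eq0.
case/orP => [/eqP d0|]; first by move: z0; rewrite zE d0 scale0r.
by rewrite subr_eq0 => /eqP d1; move: zs; rewrite zE d1 scale1r.
Qed.

Variable lam : {linear H -> k^o}.
Hypothesis lamL : sw (fun a b => (lam a : k) *: b) L = 1.

(** The trace computed with the dual bases of [lam_casimir]. *)
Lemma lin_trace_casimir (f : {linear H -> H}) :
  lin_trace f = sw (fun a b => lam (f (S b) * a)) L :> k^o.
Proof.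
transitivity (sw (fun a b => \sum_i (v2r (S b) 0 i : k) *: lam (f (std_basis i) * a))
  L); last first.
  apply: eq_sw => a b; rewrite [in RHS](std_basisE (S b)) linear_sum mulr_suml
    linear_sum.
  by apply: eq_bigr => i _; rewrite linearZ /= -scalerAl linearZ.
rewrite [RHS]tlift_sum /lin_trace /mxtrace; apply: eq_bigr => i _; rewrite mxE -dot_std.
rewrite -[in LHS](lam_casimir L_int lamL (f (std_basis i))) (linear_sw _ _ (linearP _)).
by apply: eq_sw => a b; rewrite linearZ -dot_std [RHS]mulrC.
Qed.

(** The left adjoint action of [L] on x; it maps [H] to its center. *)
Definition averaging x := sw (fun a b => a * x * S b) L.
Local Notation P := averaging.

Lemma averaging_central x : central (P x).
Proof.
move=> h; rewrite /averaging (linear_sw _ _ (linear_mulr h (@linear_id _ _))).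
rewrite (linear_sw _ _ (linear_mull h (@linear_id _ _))).
transitivity (sw (fun a b => a * x * (S b * h)) L); first by apply: eq_sw => a b;
  rewrite !mulrA.
rewrite -(@casimir _ _ _ L_int _ (fun a b => a * x * b)); last by prove_linear.
by apply: eq_sw => a b; rewrite !mulrA.
Qed.

Lemma averagingM x z : central z -> P (x * z) = P x * z.
Proof.
move=> cz; rewrite /averaging (linear_sw _ _ (linear_mulr z (@linear_id _ _))).
by apply: eq_sw => a b; rewrite -!mulrA cz.
Qed.

Variable u : H.
Hypothesis lam_u : forall x, lam x = chi (x * u).

Lemma lrmul_linear x y : linear (fun t : H => x * t * y).
Proof. by prove_linear. Qed.
Definition lrmul x y : {linear H -> H} := to_linear (lrmul_linear x y).

(** The trace is lam(x S(L_2) y L_1) = chi(x S(L_2) y L_1 u), and the cyclicity of chi collects L_1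
    u x S(L_2) in front of y. *)
Lemma lin_trace_lrmul x y : lin_trace (lrmul x y) = chi (P (u * x) * y) :> k^o.
Proof.
rewrite lin_trace_casimir /averaging (linear_sw _ _ (linear_mulr y (@linear_id _ _))).
rewrite (linear_sw _ _ (linearP chi)); apply: eq_sw => a b.
by rewrite -[LHS]/(lam (x * S b * y * a)) lam_u -[x * S b * y * a * u]mulrA [LHS]chiC
  !mulrA.
Qed.

Lemma lin_trace_lrmul1 x : lin_trace (lrmul x 1) = chi x :> k^o.
Proof. by rewrite chiE /lin_trace /lmul_mx; congr (\tr _); apply: eq_lin_mx => t /=;
  rewrite mulr1. Qed.

(* The element [averaging (u * x)] is central, hence acts on the block z by a
   scalar, which is read off by taking y = 1. *)
Lemma lin_trace_blocks s x y : (forall z, z \in s -> block z) -> \sum_(z <- s) z = 1 ->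
  lin_trace (lrmul x y) = \sum_(z <- s) (chi (x * z) : k) * chi (y * z) / chi z.
Proof.
move=> sb s1; rewrite lin_trace_lrmul -[y in LHS]mulr1 -s1 !mulr_sumr linear_sum.
apply: eq_big_seq => z zs; have bz := sb z zs; have [cz zz _ zc] := bz.
have [c E] := zc _ (averaging_central (u * x)).
have [n n0 chiz] := block_chi bz.
have nk : n%:R != 0 :> k by apply/eqP => /(natr_eq0 k_char0) n00; rewrite n00 in n0.
have -> : chi (x * z) = c * chi z :> k.
  by rewrite -lin_trace_lrmul1 lin_trace_lrmul mulr1 mulrA averagingM // E linearZ.
have -> : P (u * x) * (y * z) = c *: (y * z).
  by rewrite -[in LHS](cz y) mulrA E -scalerAl cz.
by rewrite linearZ chiz mulrAC mulfK.
Qed.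

End BlockDecomposition.

(** * Positivity *)

Section RootsOfUnity.
Import order perm cyclic separable cyclotomic.
Import Order.TTheory Num.Theory.
Variable k : closedFieldType.
Hypothesis k_char0 : [pchar k] =i pred0.

Lemma natr_neq0 n : (0 < n)%N -> n%:R != 0 :> k.
Proof. by rewrite ((pcharf0P k).1 k_char0) lt0n. Qed.

Lemma roots_of_unity n : (0 < n)%N ->
  exists2 rs : seq k, uniq rs & 'X^n - 1 = \prod_(x <- rs) ('X - x%:P).
Proof.
move=> n0; have [rs rsE] := closed_field_poly_normal ('X^n - 1 : {poly k}).
have lc : lead_coef ('X^n - 1 : {poly k}) = 1.
  by have /monicP := monic_Xn_sub_1 k n0.
exists rs; last by rewrite rsE lc scale1r.
by rewrite -separable_prod_XsubC -[X in separable_poly X]scale1r -lc -rsE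
  separable_Xn_sub_1 ?natr_neq0.
Qed.

Lemma prim_root_exists n : (0 < n)%N -> exists z : k, n.-primitive_root z.
Proof.
move=> n0; have [rs urs rsE] := roots_of_unity n0.
have /hasP[z _ zP] : has n.-primitive_root rs.
  apply: has_prim_root => //.
    apply/allP => x xrs; rewrite /root_of_unity rsE root_prod_XsubC //.
  by have := congr1 (fun p : {poly k} => size p) rsE;
    rewrite size_prod_XsubC size_XnsubC // => -[->].
by exists z.
Qed.

(** A is annihilated by X (X^n - 1), which has distinct roots, so it is diagonalizable with
    eigenvalues 0 or powers of z; on a nonzero eigenvalue the power n - 1 is the inverse. *)
Lemma trace_power n z m (A : 'M[k]_m) : (1 < n)%N -> n.-primitive_root z ->
    A ^+ n.+1 = A ->
  exists s : seq nat, \tr A = \sum_(a <- s) z ^+ a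
                   /\ \tr (A ^+ n.-1) = \sum_(a <- s) (z ^+ a) ^- 1.
Proof.
case: m A => [|m] A n1 zP An.
  by exists [::]; rewrite !big_nil /mxtrace !big_ord0.
have n0 : (0 < n)%N by apply: leq_trans n1.
have [rs urs rsE] := roots_of_unity n0.
have rsn x : (x \in rs) = (x ^+ n == 1).
  by rewrite -root_prod_XsubC -rsE /root !hornerE subr_eq0.
have [|P Pu /(diagonalizable_forLR Pu)[d Ad]] := (diagonalizableP A).2.
  exists (0 :: rs); first by rewrite /= urs rsn expr0n (gtn_eqF n0) eq_sym oner_eq0.
  rewrite big_cons -rsE subr0; apply: mxminpoly_min.
  by rewrite mulrBr mulr1 -exprS rmorphB /= rmorphXn /= horner_mx_X An subrr.
have {}Ad : A = invmx P *m diag_mx d *m P by rewrite [LHS]Ad mxpoly.conjVmx.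
have AX i : A ^+ i = invmx P *m (diag_mx d) ^+ i *m P.
  elim: i => [|i IHi]; first by rewrite !expr0 mulmx1 mulVmx.
  by rewrite exprS IHi [X in X * _]Ad -!mulmxE !mulmxA mulmxK // exprS -mulmxE !mulmxA.
have dX i : diag_mx d ^+ i = diag_mx (map_mx (fun x => x ^+ i) d).
  elim: i => [|i IHi].
    rewrite expr0 -[1]/(1%:M) -diag_const_mx; congr diag_mx.
    by apply/rowP => j; rewrite !mxE expr0.
  rewrite exprS IHi -mulmxE mulmx_diag; congr diag_mx; apply/rowP => j.
  by rewrite !mxE exprS.
have trX i : \tr (A ^+ i) = \sum_j d 0 j ^+ i.
  rewrite AX mxtrace_mulC mulmxA mulmxV // mul1mx dX mxtrace_diag.
  by apply: eq_bigr => j _; rewrite mxE.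
have dn j : d 0 j ^+ n.+1 = d 0 j.
  have := congr1 (fun B => P *m B *m invmx P) An;
    rewrite -{2}[A]expr1 !AX expr1 !mulmxA.
  rewrite !mulmxV // !mul1mx !mulmxK // dX => /matrixP/(_ j j).
  by rewrite !mxE eqxx !mulr1n.
(* The exponent of the j-th eigenvalue; a zero eigenvalue gets [None] and is dropped by [pmap]. *)
pose a j := if d 0 j == 0 then None else [pick i : 'I_n | d 0 j == z ^+ i].
exists (map val (pmap a (index_enum 'I_m.+1))).
have dz j : if a j is Some i then d 0 j = z ^+ i else d 0 j = 0.
  rewrite /a; case: eqP => [//|/eqP d0].
  case: pickP => [i /eqP//|noz].
  have dn1 : d 0 j ^+ n = 1 by apply: (mulfI d0); rewrite -exprS dn mulr1.
  by have [i di] := prim_rootP zP dn1; have := noz i; rewrite di eqxx.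
rewrite !big_map !big_pmap; split.
  rewrite -[A in LHS]expr1 trX; apply: eq_bigr => j _; rewrite expr1.
  by have := dz j; case: (a j).
rewrite trX; apply: eq_bigr => j _; have := dz j; case: (a j) => [i|] -> /=.
  apply: (@mulfI _ (z ^+ i)).
    by rewrite expf_eq0 (prim_root_eq0 zP) (gtn_eqF n0) andbF.
  rewrite -exprS prednK // mulfV ?expf_eq0 ?(prim_root_eq0 zP) ?(gtn_eqF n0) ?andbF //.
  by rewrite exprAC (prim_expr_order zP) expr1n.
(* A zero eigenvalue must contribute 0 to the power n - 1 too; this is where 1 < n is used. *)
by rewrite expr0n; case: (n) n1 => [|[]].
Qed.

(** The vector of powers of z is an eigenvector of the cyclic shift, and the transpose of a
    permutation matrix is its inverse. Transposition of integer matrices thus plays the part of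
    complex conjugation, which [k] does not carry. *)
Lemma ord_shift_pow n' (n := n'.+1) (z : k) : n.-primitive_root z ->
  let P := perm_mx (perm (@ordS_inj n))^-1 : 'M[int]_n in
  let y := \row_(j < n) z ^+ j in
  forall i, y *m map_mx intr (P ^+ i) = z ^+ i *: y
         /\ y *m map_mx intr (P ^+ i)^T = z ^- i *: y.
Proof.
move=> zP P y.
have z0 : z != 0 by rewrite (prim_root_eq0 zP).
have yP : y *m map_mx intr P = z *: y.
  rewrite /P map_perm_mx -col_permE; apply/rowP => j; rewrite !mxE permE /=.
  by rewrite expr_mod ?(prim_expr_order zP) // exprS.
have PT : P *m P^T = 1%:M.
  by rewrite tr_perm_mx invgK -perm_mxM mulVg perm_mx1.
have yPT : y *m map_mx intr P^T = z^-1 *: y.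
  have := congr1 (fun v => z^-1 *: (v *m map_mx intr P^T)) yP.
  by rewrite -mulmxA -map_mxM PT map_mx1 mulmx1 -scalemxAl scalerA mulVf // scale1r => <-.
have ratrM (A B : 'M[int]_n) : map_mx intr (A *m B)
  = map_mx intr A *m map_mx intr B :> 'M[k]_n.
  exact: map_mxM.
elim=> [|i [IH1 IH2]]; first by rewrite expr0 trmx1 map_mx1 mulmx1 invr1 scale1r.
split; first by rewrite exprS -mulmxE ratrM mulmxA yP -scalemxAl IH1 scalerA -exprS.
by rewrite exprSr -mulmxE trmx_mul ratrM mulmxA yPT -scalemxAl IH2 scalerA exprS invfM.
Qed.

Lemma intr_eq0 (m : int) : m%:~R = 0 :> k -> m = 0.
Proof.
by case: m => n; rewrite ?NegzE ?mulrNz => /eqP;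
  rewrite ?oppr_eq0 ((pcharf0P k).1 k_char0) => /eqP->.
Qed.

(* The sum is an eigenvalue of the integer matrix c + sum w X X^T, where X is
   the circulant matrix attached to the exponents; this matrix is positive
   definite. *)
Lemma sum_norms_nat n (z : k) (T : eqType) (r : seq T) (c : nat) (w : T -> nat)
    (s : T -> seq nat) :
    (0 < n)%N -> n.-primitive_root z -> (0 < c)%N ->
  c%:R + \sum_(t <- r) (w t)%:R *
       ((\sum_(a <- s t) z ^+ a) * (\sum_(a <- s t) z ^- a)) != 0.
Proof.
case: n => // n _ zP c0; set q := (X in X != 0).
have z0 : z != 0 by rewrite (prim_root_eq0 zP).
have := ord_shift_pow zP; set P := perm_mx _; set y := \row_j _ => /= Py.
pose X t : 'M[int]_n.+1 := \sum_(a <- s t) P ^+ a.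
pose M : 'M[int]_n.+1 := (c%:R)%:M + \sum_(t <- r) (w t)%:R *: (X t *m (X t)^T).
have mapS I (r' : seq I) (F : I -> 'M[int]_n.+1) :
    map_mx intr (\sum_(i <- r') F i) = \sum_(i <- r') map_mx intr (F i) :> 'M[k]_n.+1.
  apply/matrixP => i j; rewrite mxE !summxE rmorph_sum.
  by apply: eq_bigr => l _; rewrite mxE.
have trS I (r' : seq I) (F : I -> 'M[int]_n.+1) :
    (\sum_(i <- r') F i)^T = \sum_(i <- r') (F i)^T.
  by apply/matrixP => i j; rewrite mxE !summxE; apply: eq_bigr => l _; rewrite mxE.
have yM : y *m map_mx intr M = q *: y.
  rewrite /M map_mxD map_scalar_mx mulmxDr mul_mx_scalar rmorph_nat /q scalerDl;
    congr (_ + _).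
  rewrite mapS mulmx_sumr scaler_suml; apply: eq_bigr => t _ /=.
  rewrite map_mxZ map_mxM -scalemxAr mulmxA rmorph_nat.
  rewrite -scalerA; congr (_ *: _).
  have -> : y *m map_mx intr (X t) = (\sum_(a <- s t) z ^+ a) *: y.
    rewrite /X mapS mulmx_sumr scaler_suml; apply: eq_bigr => a _ /=.
    by rewrite (Py a).1.
  rewrite -scalemxAl -scalerA; congr (_ *: _).
  rewrite /X trS mapS mulmx_sumr scaler_suml; apply: eq_bigr => a _ /=.
  by rewrite (Py a).2.
apply/eqP => q0.
have y0 : y != 0.
  by apply/eqP => /rowP/(_ ord0)/eqP; rewrite !mxE expr0 oner_eq0.
(* A zero eigenvalue makes M singular over [k]; by characteristic 0 its integer determinant
   vanishes, and there is an integer kernel vector. *)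
have : \det (map_mx intr M : 'M[k]_n.+1) == 0.
  by apply/det0P; exists y => //; rewrite yM q0 scale0r.
rewrite det_map_mx => /eqP/intr_eq0/eqP/det0P[v v0 vM].
have vv (x : 'rV[int]_n.+1) : 0 <= (x *m x^T) 0 0.
  by rewrite mxE sumr_ge0 // => i _; rewrite mxE -expr2 sqr_ge0.
(* The quadratic form of M at v: a sum of nonnegative integers whose first term is c times the
   squared length of v. *)
have : c%:R * (v *m v^T) 0 0 + \sum_(t <- r) (w t)%:R * ((v *m X t) *m (v *m X t)^T) 0
  0 = 0.
  have := congr1 (fun x => (x *m v^T) 0 0) vM; rewrite mul0mx [RHS]mxE => E;
    rewrite -[RHS]E; symmetry.
  rewrite /M mulmxDr mul_mx_scalar mulmxDl [LHS]mxE; congr (_ + _);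
    first by rewrite -scalemxAl mxE.
  rewrite mulmx_sumr mulmx_suml summxE; apply: eq_bigr => t _.
  by rewrite -scalemxAr -scalemxAl mxE trmx_mul !mulmxA.
move/eqP; rewrite paddr_eq0 ?mulr_ge0 ?vv ?ler0n //; last first.
  by apply: sumr_ge0 => t _; rewrite mulr_ge0 ?vv ?ler0n.
rewrite mulf_eq0 pnatr_eq0 (gtn_eqF c0) /= => /andP[/eqP vv0 _]; case/negP: v0;
  apply/eqP/rowP => i; rewrite mxE.
move: vv0; rewrite mxE => /eqP; rewrite psumr_eq0 => [/allP/(_ i)|j _]; last first.
  by rewrite mxE -expr2 sqr_ge0.
by rewrite mem_index_enum mxE mulf_eq0 orbb => /(_ isT)/eqP.
Qed.

(** Multiplying by the product c of the denominators gives the sum of [sum_norms_nat], with weights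
    c / N(t). *)
Lemma sum_norms_neq0 n (z : k) (T : eqType) (r : seq T) (N : T -> nat)
    (s : T -> seq nat) :
    (0 < n)%N -> n.-primitive_root z -> (forall t, t \in r -> (0 < N t)%N) ->
  1 + \sum_(t <- r) ((\sum_(a <- s t) z ^+ a) * (\sum_(a <- s t) z ^- a)) / (N t)%:R
    != 0.
Proof.
move=> n0 zP N0; pose c := (\prod_(t <- r) N t)%N.
have c0 : (0 < c)%N by rewrite /c big_seq; apply: prodn_cond_gt0.
have := @sum_norms_nat n z T r c (fun t => c %/ N t)%N s n0 zP c0.
apply: contra => /eqP E; apply/eqP; rewrite -[RHS](mulr0 c%:R) -[in RHS]E.
rewrite mulrDr mulr1 mulr_sumr; congr (_ + _); apply: eq_big_seq => t tr.
have Nc : (N t %| c)%N.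
  by rewrite /c (big_rem t) //= dvdn_mulr.
have -> : c%:R = (c %/ N t)%:R * (N t)%:R :> k by rewrite -natrM divnK.
by rewrite -[RHS]mulrA; congr (_ * _); rewrite mulrCA mulfV ?natr_neq0 ?N0 // mulr1.
Qed.

End RootsOfUnity.

(** * The dual integral does not vanish at 1 *)

Section LarsonRadford.
Variables (k : closedFieldType) (H : hopfAlgType k).
Hypotheses (k_char0 : [pchar k] =i pred0) (H_ss : semisimple_alg H).
Implicit Types (x y z : H).
Local Notation chi := (@chi k H).
Local Notation eps := (eps H).
Local Notation S := (@antipode k H).

Lemma lmul_mxX x i : lmul_mx (x ^+ i) = lmul_mx x ^+ i.
Proof.
elim: i => [|i IHi]; first exact: lmul_mx1.
by rewrite exprSr lmul_mxM IHi exprS.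
Qed.

Lemma nth_root n (c : k) : (0 < n)%N -> exists t : k, t ^+ n = c.
Proof.
move=> n0; have /closed_rootP[t] : size ('X^n - c%:P : {poly k}) != 1%N.
  by rewrite size_XnsubC // eqSS -lt0n.
by rewrite /root !hornerE subr_eq0 => /eqP; exists t.
Qed.

Variable L : H.
Hypothesis L_int : two_sided_integral L.
Let L_l h : h * L = (eps h : k) *: L. Proof. by case: L_int. Qed.
Let L_r h : L * h = (eps h : k) *: L. Proof. by case: L_int. Qed.
Let eps_L : eps L = 1 :> k. Proof. by case: L_int. Qed.

Lemma chi_integral : chi L = 1 :> k.
Proof.
rewrite -eps_L [in RHS](std_basisE L) linear_sum; apply: eq_bigr => i _.
by rewrite mxE linearZ /= L_r linearZ mxE [RHS]mulrC.
Qed.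

(** On the block z the central u^n is a scalar t^n, so A = t^-1 u z satisfies A^n = z and A^(n-1) =
    t v z; the factors t and t^-1 cancel in the product of the traces. *)
Lemma block_root n u v z : (1 < n)%N -> central (u ^+ n) -> u * v = 1 -> block z ->
  exists A, [/\ A ^+ n.+1 = A &
    (chi (v * z) : k) * chi (u * z) = (chi A : k) * chi (A ^+ n.-1)].
Proof.
move=> n1 cu uv [cz zz z0 zc]; have n0 : (0 < n)%N by apply: leq_trans n1.
have zX i : (0 < i)%N -> z ^+ i = z.
  by elim: i => // [[|i]] // IHi _; rewrite exprS IHi.
have uvX i : u ^+ i * v ^+ i = 1.
  by elim: i => [|i IHi]; rewrite ?mulr1 // exprSr exprS mulrA -(mulrA _ u) uv mulr1.
have [c uc] := zc _ cu; have [t tn] := nth_root c n0.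
have t0 : t != 0.
  apply/eqP => t0; apply: z0; rewrite -[z]mul1r -(uvX n) -mulrA -(cz (v ^+ n)) mulrA uc.
  by rewrite -tn t0 expr0n gtn_eqF // scale0r mul0r.
have An : (t^-1 *: (u * z)) ^+ n = z.
  rewrite exprZn exprMn_comm; last by rewrite /GRing.comm cz.
  by rewrite zX // uc scalerA -tn exprVn mulVf ?scale1r // expf_eq0 (negPf t0) andbF.
exists (t^-1 *: (u * z)); split.
  by rewrite exprSr An -scalerAr mulrA cz -mulrA zz.
have -> : (t^-1 *: (u * z)) ^+ n.-1 = t *: (v * z).
  have Az : (t^-1 *: (u * z)) ^+ n.-1 * z = (t^-1 *: (u * z)) ^+ n.-1.
    case: (n) n1 => [|[|i]] //= _.
    by rewrite exprSr -mulrA -scalerAl -(mulrA u) zz.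
  have AB : (t^-1 *: (u * z)) * (t *: (v * z)) = z.
    rewrite -scalerAl -scalerAr scalerA mulVf // scale1r.
    by rewrite -mulrA (mulrA z) cz -mulrA zz mulrA uv mul1r.
  rewrite -Az -[X in _ * X = _]AB mulrA -exprSr prednK // An -scalerAr.
  by rewrite mulrA cz -mulrA zz.
rewrite !linearZ; change ((chi (v * z) : k) * chi (u * z)
  = (t^-1 * chi (u * z)) * (t * chi (v * z))).
by rewrite mulrACA mulVf // mul1r mulrC.
Qed.

Variable lam : {linear H -> k^o}.
Hypothesis lamL : sw (fun a b => (lam a : k) *: b) L = 1.
Local Notation a0 := (distinguished L lam).

Lemma distinguished_grouplike : grouplike a0.
Proof.
split.
  by rewrite comul_sw sw_distinguished //; prove_linear.
move=> a00; have := eps_distinguished lamL.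
by rewrite a00 linear0 => /esym/eqP; rewrite oner_eq0.
Qed.

(** In the dual bases the trace of S^2 is lam(S^2(S(L_2)) L_1), which is lam(L_1 S(L_2)) by
    [nakayama]. *)
Lemma lam_one_trace : lam 1 = lin_trace (to_linear (linear_app S (linearP S))) :> k^o.
Proof.
rewrite (lin_trace_casimir L_int lamL).
have : sw (fun a b => lam (a * S b)) L = (eps L : k) *: lam 1.
  by rewrite (sw_antipoder _ (linearP lam)).
rewrite eps_L scale1r => <-; apply: eq_sw => a b /=.
by rewrite (nakayama L_int lamL).
Qed.

(* With v = u^-1 we have S^2(y) = v y u, and u^n is central for some n > 1; on each
   block u is a scalar multiple of an element of order n. *)
Lemma lam_one_neq0 : lam 1 <> 0.
Proof.
have [u uE] := chi_rep k_char0 H_ss lam.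
have u_inj y : u * y = 0 -> y = 0.
  move=> uy; apply: (lam_nondegl L_int lamL) => x.
  by rewrite uE chiC mulrA uy mul0r linear0.
have [v /= uv] := @inj_surj _ _ (lmul u) u_inj 1.
have vu : v * u = 1.
  by apply/eqP; rewrite -subr_eq0; apply/eqP/u_inj;
    rewrite mulrBr mulrA uv mul1r mulr1 subrr.
(* Put lam = chi(- u) into [nakayama] and compare with the symmetry of chi. *)
have uS y : u * S (S y) = y * u.
  apply/eqP; rewrite -subr_eq0; apply/eqP/(chi_nondeg k_char0 H_ss) => x.
  have E : chi (u * S (S y) * x) = chi (y * u * x).
    have := nakayama L_int lamL x y; rewrite !uE => E.
    by rewrite -mulrA chiC E [RHS]chiC mulrA.
  by rewrite mulrBl linearB; apply/eqP; rewrite subr_eq0; exact/eqP/E.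
have SS y : S (S y) = v * y * u by rewrite -mulrA -uS mulrA vu mul1r.
have [m m0 am] := grouplike_order distinguished_grouplike (antipode_distinguished_r
  L_int lamL).
(* S^4 is conjugation by u^-2 according to [SS], and by a0 according to [antipode4]. *)
have cc : central (u ^+ 2 * a0).
  move=> x; rewrite -mulrA (antipode4 L_int lamL) !SS !mulrA expr2.
  by rewrite -(mulrA u u v) uv mulr1 uv mul1r.
have comm_cancel (U a b : H) : U * a * a = a * U * a -> a * b = 1 -> U * a = a * U.
  by move=> E ab; rewrite -[LHS]mulr1 -ab mulrA E -mulrA ab mulr1.
have ca : GRing.comm (u ^+ 2) a0.
  apply: (comm_cancel _ _ (S a0)); first by rewrite cc mulrA.
  exact: (antipode_distinguished_r L_int lamL).
(* As a0 commutes with u^2 and has a0^m = 1, the power u^(2m) is the m-th power of the central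
   element u^2 a0. *)
pose n := (2 * m)%N.
have n1 : (1 < n)%N by rewrite /n; case: (m) m0 => // i _; rewrite mulnS.
have cu : central (u ^+ n).
  have <- : (u ^+ 2 * a0) ^+ m = u ^+ n by rewrite (exprMn_comm m ca) am mulr1 -exprM.
  move=> x; elim: (m) => [|i IHi]; first by rewrite expr0 mul1r mulr1.
  by rewrite exprS -mulrA IHi mulrA cc -mulrA.
have [z zP] := prim_root_exists k_char0 (ltnW n1).
have [s sb s1] := blocks_exist k_char0 H_ss.
have Ls := integral_block L_int sb s1.
have roots (t : H) : exists r : seq nat, t \in s ->
    (chi (v * t) : k) * chi (u * t)
    = (\sum_(a <- r) z ^+ a) * (\sum_(a <- r) z ^- a).
  have [ts|nts] := boolP (t \in s); last by exists [::].
  have [A [An ->]] := block_root n1 cu uv (sb t ts).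
  have [|r [r1 r2]] := trace_power k_char0 n1 zP (A := lmul_mx A);
    first by rewrite -lmul_mxX An.
  by exists r => _; rewrite -r1 -r2 -lmul_mxX !chiE.
have ranks (t : H) : exists N : nat, t \in s -> (0 < N)%N /\ chi t = N%:R :> k.
  have [ts|nts] := boolP (t \in s); last by exists 0%N.
  by have [N N0 tN] := block_chi (sb t ts); exists N.
have [r rP] := choice roots; have [N NP] := choice ranks.
(* This is the trace of S^2. The block [L] is split off; its term is eps(v) eps(u) = eps(v u) =
   1. *)
have E : lin_trace (lrmul v u) = 1 + \sum_(t <- rem L s)
    ((\sum_(a <- r t) z ^+ a) * (\sum_(a <- r t) z ^- a)) / (N t)%:R.
  rewrite (lin_trace_blocks k_char0 L_int lamL uE v u sb s1) (big_rem L) //=.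
  congr (_ + _).
    transitivity ((chi (v * L) : k) * chi (u * L) / chi L) => //;
      rewrite chi_integral divr1 !L_l !linearZ.
    change ((eps v * chi L) * (eps u * chi L) = 1 :> k).
    by rewrite chi_integral !mulr1 -epsM vu eps1.
  by apply: eq_big_seq => t /mem_rem ts;
    rewrite -[chi_fun t]/(chi t : k) rP // (NP t ts).2.
move=> lam10; have := @sum_norms_neq0 k k_char0 n z _ (rem L s) N r (ltnW n1) zP.
rewrite -E -[lin_trace _](_ : lin_trace (to_linear (linear_app S (linearP S))) = _);
  last first.
  by congr (\tr _); apply: eq_lin_mx => x /=; rewrite SS.
rewrite -lam_one_trace lam10 eqxx => F; have // : false.
by apply: F => t /mem_rem ts; apply: (NP t ts).1.
Qed.

End LarsonRadford.

(** As lam(1) is not zero, [lam_integral_l] at 1 forces the distinguished grouplike to be 1, so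
    [lam] is a two-sided integral of the dual; divide it by lam(1). *)
Theorem exists_cointegral (k : closedFieldType) (H : hopfAlgType k) :
    [pchar k] =i pred0 -> semisimple_alg H ->
  exists lam : {linear H -> k^o},
    [/\ lam 1 = 1 :> k,
        forall h, sw (fun a b => (lam a : k) *: b) h = (lam h : k) *: 1,
        forall h, sw (fun a b => (lam b : k) *: a) h = (lam h : k) *: 1,
        forall x y, lam (antipode (antipode y) * x) = lam (x * y)
      & forall y : H, exists x, antipode x = y].
Proof.
move=> k0 ss; have [L L_int] := exists_integral ss.
have [lam lamL] := sw_dual_surj L_int 1.
have lam1 := lam_one_neq0 k0 ss L_int lamL.
have a1 : distinguished L lam = 1.
  have := lam_integral_l L_int lamL 1; rewrite sw1; last by prove_linear.
  move/eqP; rewrite eq_sym -subr_eq0 -scalerBr scaler_eq0 => /orP[/eqP//|].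
  by rewrite subr_eq0 => /eqP.
pose mu : {linear H -> k^o} := to_linear (linear_scaler (lam 1 : k)^-1 (linearP lam)).
have muE x : mu x = (lam 1 : k)^-1 * lam x by [].
exists mu; split.
- by rewrite muE mulVf //; apply/eqP.
- move=> h; rewrite muE -scalerA -(lam_integral_r L_int lamL).
  rewrite (linear_sw _ _ (linear_scaler _ (@linear_id _ _))).
  by apply: eq_sw => a b; rewrite scalerA.
- move=> h; rewrite muE -scalerA -[X in _ *: (_ *: X)]a1 -(lam_integral_l L_int lamL).
  rewrite (linear_sw _ _ (linear_scaler _ (@linear_id _ _))).
  by apply: eq_sw => a b; rewrite scalerA.
- by move=> x y; rewrite !muE (nakayama L_int lamL).
- exact: (antipode_surj L_int lamL).
Qed.

(** * Subcoalgebras *)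

Section TensorSubspace.
Variables (k : fieldType) (H : hopfAlgType k).
Implicit Types (A B C D X Y Z : {vspace H}).
Local Notation eps := (eps H).

Lemma tlift_mem (V W U : vectType k) (A : {vspace V}) (B : {vspace W})
    (F : V -> W -> U) (X : {vspace U}) t : bilin F ->
    t \in tensv A B -> (forall a b, a \in A -> b \in B -> F a b \in X) ->
  tlift F t \in X.
Proof.
move=> bF tAB FX; pose f := to_linear (tlift_linear F).
suff /subvP/(_ t tAB) : (tensv A B <= linfun f @^-1: X)%VS.
  by rewrite -memv_preim lfunE.
apply: vspan_sub => _ [a [b [aA bB ->]]].
by rewrite -memv_preim lfunE /= tliftE ?FX.
Qed.

Lemma mem_tens (V W : vectType k) (A : {vspace V}) (B : {vspace W}) a b :
  a \in A -> b \in B -> a \ox b \in tensv A B.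
Proof. by move=> aA bB; apply: mem_vspan; exists a, b. Qed.

Lemma tlift_tens_id (V W : vectType k) (t : tensor V W) : tlift (fun a b =>
  a \ox b) t = t.
Proof. exact: esym (tensor_std_sum t). Qed.

(** Expanding one leg in the standard basis leaves slices in the other, so projecting the first leg
    to [A] or the second to [B] fixes t. Doing both shows membership. *)
Lemma slices_mem_tensv A B (t : tensor H H) :
    (forall f : {linear H -> k^o}, tlift (fun a b => (f b : k) *: a) t \in A) ->
    (forall f : {linear H -> k^o}, tlift (fun a b => (f a : k) *: b) t \in B) ->
  t \in tensv A B.
Proof.
move=> tA tB.
have E1 : tlift (fun a b => projv A a \ox b) t = t.
  rewrite -[RHS]tlift_tens_id.
  have E (p : {linear H -> H}) : tlift (fun a b => p a \ox b) t
      = \sum_i p (tlift (fun a b => (dot (std_basis i) b : k) *: a) t) \ox std_basis i.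
    transitivity (tlift (fun a b => \sum_i (v2r b 0 i *: p a) \ox std_basis i) t).
      apply: eq_tlift => a b; rewrite {1}(std_basisE b) -[LHS]/(to_linear (linear_tensr
        _ (@linear_id _ _)) _).
      rewrite linear_sum; apply: eq_bigr => i _; rewrite linearZ /=.
      by rewrite -[RHS]/(to_linear (linear_tensl _ (@linear_id _ _)) _) linearZ.
    transitivity (\sum_i tlift (fun a b => (v2r b 0 i *: p a) \ox std_basis i) t).
      by rewrite tlift_sum.
    apply: eq_bigr => i _; rewrite (linear_tlift _ _ (linearP p)).
    rewrite (linear_tlift _ _ (linear_tensl _ (@linear_id _ _))).
    by apply: eq_tlift => a b; rewrite linearZ dot_std.
  rewrite (E (projv A)) [RHS](E (to_linear (@linear_id _ H))).
  by apply: eq_bigr => i _; congr (_ \ox _); apply: projv_id.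
have E2 : tlift (fun a b => a \ox projv B b) t = t.
  rewrite -[RHS]tlift_tens_id.
  have E (p : {linear H -> H}) : tlift (fun a b => a \ox p b) t
      = \sum_i std_basis i \ox p (tlift (fun a b => (dot (std_basis i) a : k) *: b) t).
    transitivity (tlift (fun a b => \sum_i std_basis i \ox (v2r a 0 i *: p b)) t).
      apply: eq_tlift => a b; rewrite {1}(std_basisE a) -[LHS]/(to_linear (linear_tensl
        _ (@linear_id _ _)) _).
      rewrite linear_sum; apply: eq_bigr => i _; rewrite linearZ /=.
      by rewrite -[RHS]/(to_linear (linear_tensr _ (@linear_id _ _)) _) linearZ.
    transitivity (\sum_i tlift (fun a b => std_basis i \ox (v2r a 0 i *: p b)) t).
      by rewrite tlift_sum.
    apply: eq_bigr => i _; rewrite (linear_tlift _ _ (linearP p)).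
    rewrite (linear_tlift _ _ (linear_tensr _ (@linear_id _ _))).
    by apply: eq_tlift => a b; rewrite linearZ dot_std.
  rewrite (E (projv B)) [RHS](E (to_linear (@linear_id _ H))).
  by apply: eq_bigr => i _; congr (_ \ox _); apply: projv_id.
rewrite -E1 -[X in tlift _ X]E2 tlift_tens; last by prove_linear.
rewrite /tlift; apply: memv_suml => i _; apply: memv_suml => j _.
by rewrite memvZ // mem_tens ?memv_proj.
Qed.

Lemma subcoalgP X : subcoalg X <->
  forall (f : {linear H -> k^o}) x, x \in X ->
    sw (fun a b => (f b : k) *: a) x \in X /\ sw (fun a b => (f a : k) *: b) x \in X.
Proof.
split=> [cX f x xX|cX x xX].
  by split; apply: (tlift_mem _ (cX x xX)); try (by prove_linear); move=> a b aX bX;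
    rewrite memvZ.
by apply: slices_mem_tensv => f; have [] := cX f x xX.
Qed.

Lemma subcoalg_cap X Y : subcoalg X -> subcoalg Y -> subcoalg (X :&: Y).
Proof.
move=> /subcoalgP cX /subcoalgP cY; apply/subcoalgP => f x.
by rewrite memv_cap => /andP[/(cX f)[? ?] /(cY f)[? ?]]; split; rewrite memv_cap;
  apply/andP.
Qed.

Lemma subcoalg_vspan (A : classical_sets.set H) :
    (forall (f : {linear H -> k^o}) x, A x ->
       sw (fun a b => (f b : k) *: a) x \in vspan A
    /\ sw (fun a b => (f a : k) *: b) x \in vspan A) ->
  subcoalg (vspan A).
Proof.
move=> cA; apply/subcoalgP => f x xA.
have l1 : linear (fun x => sw (fun a b => (f b : k) *: a) x) by prove_linear.
have l2 : linear (fun x => sw (fun a b => (f a : k) *: b) x) by prove_linear.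
have /subvP/(_ x xA) : (vspan A <= (linfun (to_linear l1) @^-1: vspan A)
                                :&: (linfun (to_linear l2) @^-1: vspan A))%VS.
  apply: vspan_sub => y Ay; have [y1 y2] := cA f y Ay.
  by rewrite memv_cap -!memv_preim !lfunE /= y1 y2.
by rewrite memv_cap -!memv_preim !lfunE => /andP.
Qed.

Lemma subcoalg_sum I (r : seq I) (P : pred I) (F : I -> {vspace H}) :
  (forall i, P i -> subcoalg (F i)) -> subcoalg (\sum_(i <- r | P i) F i)%VS.
Proof.
move=> cF; apply: (big_ind (fun X => subcoalg X)) => [|X Y cX cY|//].
  move=> x; rewrite memv0 => /eqP->; rewrite linear0; exact: mem0v.
apply/subcoalgP => f _ /memv_addP[x xX [y yY ->]].
have l1 : linear (fun x => sw (fun a b => (f b : k) *: a) x) by prove_linear.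
have l2 : linear (fun x => sw (fun a b => (f a : k) *: b) x) by prove_linear.
rewrite -[sw (fun a b => (f b : k) *: a) (x + y)]/(to_linear l1 (x + y)).
rewrite -[sw (fun a b => (f a : k) *: b) (x + y)]/(to_linear l2 (x + y)).
move/subcoalgP: cX => /(_ f x xX)[? ?]; move/subcoalgP: cY => /(_ f y yY)[? ?].
by split; rewrite linearD memv_add.
Qed.

Lemma subcoalg_prod X Y : subcoalg X -> subcoalg Y -> subcoalg (X * Y)%VS.
Proof.
move=> cX cY; apply/subcoalgP => f z zXY.
have l1 : linear (fun x => sw (fun a b => (f b : k) *: a) x) by prove_linear.
have l2 : linear (fun x => sw (fun a b => (f a : k) *: b) x) by prove_linear.
have /subvP/(_ z zXY) : (X * Y <= (linfun (to_linear l1) @^-1: (X * Y))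
                                :&: (linfun (to_linear l2) @^-1: (X * Y)))%VS.
  apply/prodvP => x y xX yY; rewrite memv_cap -!memv_preim !lfunE /=.
  apply/andP; split; rewrite swM; try (by prove_linear).
    apply: (tlift_mem _ (cX x xX)); first by prove_linear.
    move=> a b aX bX; apply: (tlift_mem _ (cY y yY)); first by prove_linear.
    by move=> c d cY' dY; rewrite memvZ // memv_mul.
  apply: (tlift_mem _ (cX x xX)); first by prove_linear.
  move=> a b aX bX; apply: (tlift_mem _ (cY y yY)); first by prove_linear.
  by move=> c d cY' dY; rewrite memvZ // memv_mul.
by rewrite memv_cap -!memv_preim !lfunE => /andP.
Qed.

Lemma simple_subcoalg_exists X : subcoalg X -> X != 0%VS ->
  exists2 D, simple_subcoalg D & (D <= X)%VS.
Proof.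
have [n] := ubnP (\dim X); elim: n X => // n IHn X dX cX X0.
have [[D [cD DX D0 DnX]]|nD] := EM (exists D, [/\ subcoalg D, (D <= X)%VS, D <> 0%VS &
  D <> X]).
  have dD : (\dim D < \dim X)%N.
    rewrite ltn_neqAle dimvS // andbT; apply/eqP => E; apply: DnX.
    by apply/eqP; rewrite eqEdim DX E leqnn.
  have [|||E sE ED] := IHn D; rewrite ?(leq_trans dD) //; first exact/eqP.
  by exists E => //; apply: subv_trans DX.
exists X; rewrite ?subvv //; split=> // D cD DX.
apply: contrapT => /not_orP[D0 DnX]; apply: nD.
by exists D.
Qed.

End TensorSubspace.

(** * Orthogonality for the form lam(S(x) y) and cosemisimplicity *)

Section Orthogonality.
Variables (k : fieldType) (H : hopfAlgType k).
Implicit Types (h x y z : H) (A B C D K X Y Z : {vspace H}).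
Local Notation eps := (eps H).
Local Notation S := (@antipode k H).

Variable lam : {linear H -> k^o}.
Hypothesis lam1 : lam 1 = 1 :> k.
Hypothesis lam_r : forall h, sw (fun a b => (lam a : k) *: b) h = (lam h : k) *: 1.
Hypothesis lam_l : forall h, sw (fun a b => (lam b : k) *: a) h = (lam h : k) *: 1.
Hypothesis lam_nak : forall x y, lam (S (S y) * x) = lam (x * y).
Hypothesis S_surj : forall y, exists x, S x = y.

(** Expand x_1 lam(S(x_2) y) by [lam_r] applied to S(x_2) y and cancel x_1 S(x_2). The left side
    lies in any subcoalgebra containing y, the right side in any containing x. *)
Lemma lam_shift_r x y : sw (fun a b => (lam (S x * a) : k) *: b) y
  = sw (fun c d => (lam (S d * y) : k) *: c) x.
Proof.
transitivity (sw (fun c d => c * sw (fun a b => (lam a : k) *: b) (S d * y)) x);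
  last first.
  by apply: eq_sw => c d; rewrite lam_r -scalerAr mulr1.
transitivity (sw (fun c d => sw (fun d1 d2 => sw (fun a b =>
  (lam (S d2 * a) : k) *: (c * S d1 * b)) y) d) x); last first.
  apply: eq_sw => c d; rewrite swM; last by prove_linear.
  rewrite (linear_sw _ _ (linear_mull c (@linear_id _ _))) sw_antipode;
    last by prove_linear.
  apply: eq_sw => d1 d2; rewrite (linear_sw _ _ (linear_mull c (@linear_id _ _))).
  by apply: eq_sw => a b; rewrite -scalerAr mulrA.
rewrite -(@sw_assoc _ _ _ (fun c d1 d2 => sw (fun a b =>
  (lam (S d2 * a) : k) *: (c * S d1 * b)) y)); try by prove_linear.
rewrite (@sw_antipoder_id _ _ _ (fun e d2 => sw (fun a b =>
  (lam (S d2 * a) : k) *: (e * b)) y)); last by prove_linear.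
by apply: eq_sw => a b; rewrite mul1r.
Qed.

Lemma lam_shift_l x y : sw (fun a b => (lam (S x * b) : k) *: a) y
  = sw (fun c d => (lam (S c * y) : k) *: S (S d)) x.
Proof.
transitivity (sw (fun c d => S (S d) * sw (fun a b => (lam b : k) *: a) (S c * y)) x);
  last first.
  by apply: eq_sw => c d; rewrite lam_l -scalerAr mulr1.
transitivity (sw (fun c d => sw (fun c1 c2 => sw (fun a b =>
  (lam (S c1 * b) : k) *: (S (c2 * S d) * a)) y) c) x); last first.
  apply: eq_sw => c d; rewrite swM; last by prove_linear.
  rewrite (linear_sw _ _ (linear_mull _ (@linear_id _ _))) sw_antipode;
    last by prove_linear.
  apply: eq_sw => c1 c2; rewrite (linear_sw _ _ (linear_mull _ (@linear_id _ _))).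
  by apply: eq_sw => a b; rewrite -scalerAr mulrA antipodeM.
rewrite (@sw_assoc _ _ _ (fun c1 c2 d => sw (fun a b =>
  (lam (S c1 * b) : k) *: (S (c2 * S d) * a)) y)); try by prove_linear.
rewrite (@sw_id_antipoder _ _ _ (fun c1 e => sw (fun a b =>
  (lam (S c1 * b) : k) *: (S e * a)) y)); last by prove_linear.
by apply: eq_sw => a b; rewrite antipode1 mul1r.
Qed.

(** The values lam(S(b_i) y) on a basis of [X], encoded as an element of [X]: the kernel is the
    orthogonal of [X], and the image, inside [X], bounds its codimension. *)
Lemma perp_linear X : linear (fun y =>
  \sum_(i < \dim X) (lam (S (vbasis X)`_i * y) : k) *: (vbasis X)`_i).
Proof.
move=> a x y; rewrite scaler_sumr -big_split; apply: eq_bigr => i _ /=.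
by rewrite mulrDr -scalerAr linearP scalerDl scalerA.
Qed.

Definition perp_map X := linfun (to_linear (perp_linear X)).
Definition perp X := lker (perp_map X).

Lemma mem_perp X y : y \in perp X <-> forall x, x \in X -> lam (S x * y) = 0.
Proof.
rewrite memv_ker lfunE /=; split=> [/eqP y0 x xX|y0]; last first.
  by rewrite big1 // => i _; rewrite y0 ?scale0r // vbasis_mem ?mem_nth ?size_tuple.
have /freeP/(_ _ y0) c0 := basis_free (vbasisP X).
rewrite (coord_vbasis xX) linear_sum mulr_suml linear_sum big1 // => i _.
by rewrite linearZ /= -scalerAl linearZ /= c0; apply: mulr0.
Qed.

Lemma sw_eq0 (U : vectType k) (F : H -> H -> U) X x : bilin F -> subcoalg X ->
  x \in X ->
  (forall a b, a \in X -> b \in X -> F a b = 0) -> sw F x = 0.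
Proof.
move=> bF cX xX F0; apply/eqP; rewrite -memv0.
by apply: (tlift_mem bF (cX x xX)) => a b aX bX; rewrite F0 ?mem0v.
Qed.

(** By the two shift formulas, pairing x with a slice of y amounts to pairing y with a leg of x,
    which is still in [X]. *)
Lemma perp_subcoalg X : subcoalg X -> subcoalg (perp X).
Proof.
move=> cX; apply/subcoalgP => f y /mem_perp y0; split; apply/mem_perp => x xX.
  transitivity (f (sw (fun a b => (lam (S x * a) : k) *: b) y)).
    rewrite (linear_sw _ _ (linear_mull _ (@linear_id _ _))) (linear_sw _ _ (linearP
      lam)).
    rewrite (linear_sw _ _ (linearP f)); apply: eq_sw => a b.
    by rewrite -scalerAr !linearZ /= [RHS]mulrC.
  rewrite lam_shift_r (sw_eq0 _ cX xX) ?linear0 //; first by prove_linear.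
  by move=> a b _ bX; rewrite y0 // scale0r.
transitivity (f (sw (fun a b => (lam (S x * b) : k) *: a) y)).
  rewrite (linear_sw _ _ (linear_mull _ (@linear_id _ _))) (linear_sw _ _ (linearP
    lam)).
  rewrite (linear_sw _ _ (linearP f)); apply: eq_sw => a b.
  by rewrite -scalerAr !linearZ /= [RHS]mulrC.
rewrite lam_shift_l (sw_eq0 _ cX xX) ?linear0 //; first by prove_linear.
by move=> a b aX _; rewrite y0 // scale0r.
Qed.

Lemma eps_subcoalg0 Z : subcoalg Z -> (forall z, z \in Z -> eps z = 0 :> k) -> Z = 0%VS.
Proof.
move=> cZ e0; apply/eqP; rewrite -subv0; apply/subvP => z zZ; rewrite memv0.
rewrite -[z](@sw_counitl _ _ _ id z (@linear_id _ _)) (sw_eq0 _ cZ zZ) //;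
  first by prove_linear.
by move=> a b aZ _; rewrite e0 // scale0r.
Qed.

(** From lam(1) = 1 one gets eps(z) = lam(S(z_1) z_2), so the counit vanishes on a totally isotropic
    subcoalgebra. *)
Lemma self_perp_eq0 Z : subcoalg Z -> (Z <= perp Z)%VS -> Z = 0%VS.
Proof.
move=> cZ ZZ; apply: eps_subcoalg0 => // z zZ.
have := sw_antipodel z (linearP lam); rewrite lam1 => E.
have {}E : eps z = sw (fun a b => lam (S a * b)) z :> k^o by rewrite E [RHS]mulr1.
rewrite E (sw_eq0 (U := k^o) _ cZ zZ) //; first by prove_linear.
by move=> a b aZ bZ; apply: (mem_perp Z b).1 => //; apply: (subvP ZZ).
Qed.

(** The element lam(S(x) y_1) y_2 lies in [Y], and in [X] by [lam_shift_r], so it is 0; its counit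
    is lam(S(x) y). *)
Lemma subcoalg_orthogonal X Y x y : subcoalg X -> subcoalg Y -> (X :&: Y = 0)%VS ->
  x \in X -> y \in Y -> lam (S x * y) = 0.
Proof.
move=> cX cY XY xX yY; pose v := sw (fun a b => (lam (S x * a) : k) *: b) y.
have vY : v \in Y.
  apply: (tlift_mem _ (cY y yY)); first by prove_linear.
  by move=> a b _ bY; rewrite memvZ.
have vX : v \in X.
  rewrite /v lam_shift_r; apply: (tlift_mem _ (cX x xX)); first by prove_linear.
  by move=> a b aX _; rewrite memvZ.
have v0 : v = 0 by apply/eqP; rewrite -memv0 -XY memv_cap vX vY.
transitivity (eps v); last by rewrite v0 linear0.
rewrite /v (linear_sw _ _ (linearP eps)).
transitivity (sw (fun a b => (eps b : k) *: lam (S x * a)) y).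
  by rewrite (@sw_counitr _ _ _ (fun a => lam (S x * a))) //; prove_linear.
by apply: eq_sw => a b; rewrite linearZ [RHS]mulrC.
Qed.

(** Let X be the span of the simple subcoalgebras of [K]. A simple subcoalgebra in the intersection
    of [K] with the orthogonal of X would lie in X and be isotropic; so this intersection is 0. *)
Lemma subcoalg_sub_simple K W : subcoalg K ->
  (forall D, simple_subcoalg D -> (D <= K)%VS -> (D <= W)%VS) -> (K <= W)%VS.
Proof.
move=> cK DW.
pose A : classical_sets.set H := fun x => exists D, [/\ simple_subcoalg D, (D <= K)%VS
  & x \in D].
pose X := vspan A.
have XK : (X <= K)%VS by apply: vspan_sub => x [D [_ /subvP DK /DK]].
have XW : (X <= W)%VS.
  by apply: vspan_sub => x [D [sD DK xD]]; apply: (subvP (DW D sD DK)).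
have DX D : simple_subcoalg D -> (D <= K)%VS -> (D <= X)%VS.
  by move=> sD DK; apply/subvP => x xD; apply: mem_vspan; exists D.
have cX : subcoalg X.
  apply: subcoalg_vspan => f x [D [sD DK xD]].
  have [_ cD _] := sD; have /subcoalgP/(_ f x xD)[x1 x2] := cD.
  by split; apply: (subvP (DX D sD DK)).
have X0 : (K :&: perp X = 0)%VS.
  apply/eqP/negPn/negP => nz.
  have [|D sD] := simple_subcoalg_exists _ nz.
    exact: subcoalg_cap cK (perp_subcoalg cX).
  rewrite subv_cap => /andP[DK DP]; have [D0 cD _] := sD.
  case/negP: D0; apply/eqP/self_perp_eq0 => //.
  apply/subvP => y yD; apply/mem_perp => x xD.
  by apply: (mem_perp X y).1; [exact: (subvP DP)|exact: (subvP (DX D sD DK))].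
suff -> : K = X by [].
apply/eqP; rewrite eq_sym eqEdim XK /=.
(* On [K] the map [perp_map X] is injective with values in X, so dim K is at most dim X. *)
rewrite -(limg_ker_dim (perp_map X) K) -/(perp X) X0 dimv0 add0n.
apply/dimvS/subvP => _ /memv_imgP[y _ ->]; rewrite lfunE /=.
by apply: memv_suml => i _; rewrite memvZ // vbasis_mem ?mem_nth ?size_tuple.
Qed.

(** * Normal Hopf subalgebras *)

Section Normal.
Variable K : {vspace H}.
Hypothesis K_normal : normal_hopf_subalg K.

Let K1 : 1 \in K. Proof. by case: K_normal => -[]. Qed.
Let KM x y : x \in K -> y \in K -> x * y \in K.
Proof. by case: K_normal => -[_ KM _ _] _ _; apply: KM. Qed.
Let cK : subcoalg K. Proof. by case: K_normal => -[]. Qed.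
Let KS x : x \in K -> S x \in K. Proof. by case: K_normal => -[_ _ _ KS] _ _;
  apply: KS. Qed.

(** Insert S(h_2) h_3 after h_1 x: the analogue of g x = (g x g^-1) g in a group. *)
Lemma mul_ad_left h x : h * x = sw (fun a b => ad_left a x * b) h.
Proof.
rewrite -[LHS]mulr1 -(@sw_id_antipodel _ _ _ (fun a b => a * x * b));
  last by prove_linear.
rewrite -(@sw_assoc _ _ _ (fun a b c => a * x * (S b * c))); try by prove_linear.
apply: eq_sw => a b; rewrite /ad_left -/(@sw k H _ _ _).
rewrite [RHS](linear_sw _ _ (linear_mulr b (@linear_id _ _))).
by apply: eq_sw => c d; rewrite !mulrA.
Qed.

Lemma mul_ad_right x h : x * h = sw (fun a b => a * ad_right b x) h.
Proof.
rewrite -[LHS]mul1r -(@sw_antipoder_id _ _ _ (fun a b => a * (x * b)));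
  last by prove_linear.
rewrite (@sw_assoc _ _ _ (fun a b c => a * S b * (x * c))); try by prove_linear.
apply: eq_sw => a b; rewrite /ad_right -/(@sw k H _ _ _).
rewrite [RHS](linear_sw _ _ (linear_mull a (@linear_id _ _))).
by apply: eq_sw => c d; rewrite !mulrA.
Qed.

Lemma eps_ad_right h x : eps (ad_right h x) = (eps h : k) * eps x :> k^o.
Proof.
rewrite /ad_right -/(@sw k H _ _ _) (linear_sw _ _ (linearP eps)).
transitivity (sw (fun a b => (eps a : k) *: eps (b * x)) h).
  apply: eq_sw => a b; rewrite !epsM eps_antipode.
  by rewrite -[RHS]/(eps a * (eps b * eps x)) -mulrA [eps x * _]mulrC.
by rewrite (@sw_counitl _ _ _ (fun b => eps (b * x))) ?epsM //; prove_linear.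
Qed.

Lemma eps_ad_left h x : eps (ad_left h x) = (eps h : k) * eps x :> k^o.
Proof.
rewrite /ad_left -/(@sw k H _ _ _) (linear_sw _ _ (linearP eps)).
transitivity (sw (fun a b => (eps a : k) *: eps (b * x)) h).
  apply: eq_sw => a b; rewrite !epsM eps_antipode.
  by rewrite -[RHS]/(eps a * (eps b * eps x)) -mulrA [eps x * _]mulrC.
by rewrite (@sw_counitl _ _ _ (fun b => eps (b * x))) ?epsM //; prove_linear.
Qed.

Lemma linear_ad_left x : linear (fun h => ad_left h x).
Proof. by rewrite /ad_left; prove_linear. Qed.

Lemma linear_ad_right x : linear (fun h => ad_right h x).
Proof. by rewrite /ad_right; prove_linear. Qed.

Lemma normal_prodC C : subcoalg C -> (K * C = C * K)%VS.
Proof.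
move=> cC; apply/eqP; rewrite eqEsubv; apply/andP; split; apply/prodvP => x y xX yY.
  rewrite mul_ad_right; apply: (tlift_mem _ (cC y yY)).
    by split=> ?; prove_linear; exact: linear_ad_right.
  by move=> a b aC bC; rewrite memv_mul //; case: K_normal => _ _; apply.
rewrite mul_ad_left; apply: (tlift_mem _ (cC x xX)).
  by split=> ?; prove_linear; exact: linear_ad_left.
by move=> a b aC bC; rewrite memv_mul //; case: K_normal => _ + _; apply.
Qed.

Lemma normal_prodK X : (X * K * K = X * K)%VS.
Proof.
apply/eqP; rewrite eqEsubv; apply/andP; split; last first.
  by apply/subvP => x xX; rewrite -[x]mulr1 memv_mul.
by rewrite -prodvA prodvSr //; apply/prodvP => x y; apply: KM.
Qed.

Lemma normal_dcoset C : subcoalg C -> (K * C * K = C * K)%VS.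
Proof. by move=> cC; rewrite normal_prodC // normal_prodK. Qed.

(** By normality, ad(h)(z) lies in [K], and moving x in [K] across h_1 by [mul_ad_right] shows that
    it is a left integral of [K]. So it is eps(h) z, and h z = ad(h_1)(z) h_2 = z h. *)
Lemma normal_integral_central z : norm_integral K z -> central z.
Proof.
case=> zK zI ez.
have adz h : ad_left h z = (eps h : k) *: z.
  have adK : ad_left h z \in K by case: K_normal => _ + _; apply.
  have zl x : x \in K -> x * ad_left h z = (eps x : k) *: ad_left h z.
    move=> xK; rewrite /ad_left -/(@sw k H _ _ _) (linear_sw _ _ (linear_mull x
      (@linear_id _ _))).
    rewrite (linear_sw _ _ (linear_scaler _ (@linear_id _ _))); apply: eq_sw => a b.
    rewrite !mulrA [x * a]mul_ad_right scalerAl; congr (_ * _).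
    transitivity (sw (fun c d => (eps d : k) *: ((eps x : k) *: (c * z))) a).
      rewrite (linear_sw _ _ (linear_mulr z (@linear_id _ _))); apply: eq_sw => c d.
      have dK : ad_right d x \in K by case: K_normal => _ _; apply.
      by rewrite -mulrA (zI _ dK).1 eps_ad_right -scalerAr scalerA.
    by rewrite (@sw_counitr _ _ _ (fun c => (eps x : k) *: (c * z))) ?scalerAl //;
      prove_linear.
  have := (zI _ adK).2; rewrite zl // ez scale1r => ->.
  by rewrite -/(eps _) eps_ad_left ez mulr1.
move=> h; rewrite [RHS]mul_ad_left.
transitivity (sw (fun a b => (eps a : k) *: (z * b)) h).
  by rewrite (@sw_counitl _ _ _ (fun b => z * b)) //; prove_linear.
by apply: eq_sw => a b; rewrite adz scalerAl.
Qed.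

Lemma subcoalg_char_mem D : subcoalg_char D \in D.
Proof.
rewrite /subcoalg_char; case: classical_sets.xgetP => [c _ [n [x [[bD _] ->]]]|_];
  last exact: mem0v.
apply: memv_suml => i _; apply: (basis_mem bD).
by apply/mapP; exists (i, i); rewrite ?mem_enum.
Qed.

(* If K has no normalized integral then [integral K] is 0 and the condition
   defining [conj_hopf C K] is trivial. *)
Lemma normal_sub_conj C : (K <= conj_hopf C K)%VS.
Proof.
apply: subcoalg_sub_simple => // D sD DK; apply/subvP => x xD; apply: mem_vspan.
exists D; split=> //=; have dK := subvP DK _ (subcoalg_char_mem D).
rewrite /integral; case: classical_sets.xgetP => [z _ zI|_];
  last by rewrite !mulr0 scaler0.
(* With z central and d in [K], d c z = d z c = eps(d) z c. *)
have cz := normal_integral_central zI; have [_ zl _] := zI.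
by rewrite -mulrA -cz mulrA (zl _ dK).1 -scalerAl cz.
Qed.

Lemma antipode_sub_surj y : y \in K -> exists2 x, x \in K & S x = y.
Proof.
have SK : (linfun S @: K = K)%VS.
  apply/eqP; rewrite eqEdim; apply/andP; split.
    by apply/subvP => _ /memv_imgP[x xK ->]; rewrite lfunE /= KS.
  rewrite limg_dim_eq //; apply/eqP; rewrite -subv0; apply/subvP => x.
  rewrite memv_cap memv_ker lfunE memv0 /= => /andP[_ /eqP Sx].
  by apply/eqP/(surj_inj S_surj).
by rewrite -{1}SK => /memv_imgP[x xK ->]; exists x; rewrite ?lfunE.
Qed.

(* By [lam_nak], lam (S (c k) c' k') = lam (S(c) c' k' S^-1(k)). *)
Lemma normal_orthogonal C C' x y : subcoalg C -> subcoalg C' -> (C :&: C' * K = 0)%VS ->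
  x \in (C * K)%VS -> y \in (C' * K)%VS -> lam (S x * y) = 0.
Proof.
move=> cC cC' CC' xC yC.
have lL : linear (fun x => lam (S x * y)) by prove_linear.
have /subvP/(_ x xC) : (C * K <= lker (linfun (to_linear lL)))%VS.
  apply/prodvP => c h cC1 hK; rewrite memv_ker lfunE /=; apply/eqP.
  have [g gK <-] := antipode_sub_surj hK.
  rewrite antipodeM -mulrA lam_nak -mulrA.
  apply: (subcoalg_orthogonal cC (subcoalg_prod cC' cK) CC' cC1).
  by rewrite -normal_prodK memv_mul.
by rewrite memv_ker lfunE => /eqP.
Qed.

(** The subcoalgebras C_i K, which are the double cosets K C_i K, are pairwise orthogonal and span
    [H]; the p_i are the projections of the resulting direct sum. *)
Lemma normal_decomposition n (C : 'I_n -> {vspace H}) : dcoset_reps K K C ->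
  exists p : 'I_n -> {linear H -> H},
    [/\ forall i h, p i h \in (C i * K)%VS, forall h, \sum_i p i h = h
      & forall i j h, h \in (C j * K)%VS -> p i h = if i == j then h else 0].
Proof.
case=> sC covC distC; pose V i := (C i * K)%VS.
have cC i : subcoalg (C i) by case: (sC i).
have cV i : subcoalg (V i) by apply: subcoalg_prod.
have VE i : (K * C i * K)%VS = V i by apply: normal_dcoset.
(* The intersection of C_i with C_j K is a subcoalgebra of the simple C_i; if it were C_i, then C_i
   and C_j would represent the same double coset. *)
have orthV i j x y : i != j -> x \in V i -> y \in V j -> lam (S x * y) = 0.
  move=> ij; apply: normal_orthogonal => //.
  have [_ _ minC] := sC i.
  have [//|E] := minC _ (subcoalg_cap (cC i) (cV j)) (capvSl _ _).
  case/eqP: ij; apply: distC; rewrite /dcoset_rel VE -[X in (X <= _)%VS]E;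
    exact: capvSr.
have fullV : (\sum_i V i)%VS = fullv.
  apply/eqP; rewrite eqEsubv subvf /=; apply: subcoalg_sub_simple.
    by apply/subcoalgP => f x _; split; exact: memvf.
  move=> D sD _; have [i Di] := covC D sD.
  by apply: subv_trans Di _; rewrite VE (sumv_sup i).
(* V_i meets the sum of the other V_j in a subcoalgebra orthogonal to itself. *)
have indepV (v : 'I_n -> H) : (forall i, v i \in V i) -> \sum_i v i = 0 ->
  forall i, v i = 0.
  move=> vV v0 i; pose Z := (V i :&: \sum_(j | j != i) V j)%VS.
  have Z0 : Z = 0%VS.
    apply: self_perp_eq0.
      by apply: subcoalg_cap => //; apply: subcoalg_sum.
    apply/subvP => y; rewrite memv_cap => /andP[_ /memv_sumP[w wV ->]].
    apply/mem_perp => x; rewrite memv_cap => /andP[xV _].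
    rewrite mulr_sumr linear_sum big1 // => j ji.
    by apply: (orthV i j); rewrite // 1?eq_sym // wV.
  apply/eqP; rewrite -memv0 -Z0 memv_cap vV /=.
  have -> : v i = - \sum_(j | j != i) v j.
    by move: v0; rewrite (bigD1 i) //= => /eqP; rewrite addr_eq0 => /eqP.
  by rewrite memvN; apply: memv_sumr.
have decV h : exists v : 'I_n -> H, (forall i, v i \in V i) /\ \sum_i v i = h.
  have : h \in (\sum_i V i)%VS by rewrite fullV memvf.
  by case/memv_sumP => v vV ->; exists v; split=> // i; apply: vV.
have [v vP] := choice decV.
have uniqV (w w' : 'I_n -> H) : (forall i, w i \in V i) -> (forall i, w' i \in V i) ->
    \sum_i w i = \sum_i w' i -> forall i, w i = w' i.
  move=> wV w'V ww' i; apply/eqP; rewrite -subr_eq0; apply/eqP.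
  apply: (indepV (fun i => w i - w' i)) => [j|]; first by rewrite memvB.
  by rewrite sumrB ww' subrr.
(* The components were obtained by choice; their uniqueness makes them linear. *)
have lv i : linear (fun h => v h i).
  move=> a x y; apply: (uniqV (v (a *: x + y)) (fun i => a *: v x i + v y i)).
  - exact: (vP _).1.
  - by move=> j; rewrite memvD ?memvZ ?(vP _).1.
  - by rewrite big_split /= -scaler_sumr !(vP _).2.
exists (fun i => to_linear (lv i)); split=> [i h|h|i j h hV] /=;
  [exact: (vP h).1|exact: (vP h).2|].
apply: (uniqV (v h) (fun i => if i == j then h else 0)).
- exact: (vP _).1.
- by move=> l; case: eqP => [->//|_]; exact: mem0v.
- by rewrite (vP h).2 -big_mkcond big_pred1_eq.
Qed.

End Normal.
End Orthogonality.

(** * The Mackey map *)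

Section BalancedLift.
Variables (k : fieldType) (H : hopfAlgType k) (A X : {vspace H}).
Variables (M : vectType k) (act : subvs_of A -> M -> M).
Local Notation XM := (btensor X act).

Lemma btens_linearl m : linear (fun x => btens X act x m).
Proof.
move=> a x y; rewrite /btens -(quo_class_linear (bal_rel X act)); congr quo_class.
by rewrite linearP; apply: (tens_bilin _ _).2.
Qed.

Lemma btens_linearr x : linear (fun m => btens X act x m).
Proof.
move=> a m m'; rewrite /btens -(quo_class_linear (bal_rel X act)); congr quo_class.
by apply: (tens_bilin _ _).1.
Qed.

Lemma quo_repr_linear (V : vectType k) (U : {vspace V}) : linear (@quo_repr k V U).
Proof. by move=> a u v; rewrite /quo_repr linearP. Qed.

Lemma btensor_eq (U : lmodType k) (f g : XM -> U) : linear f -> linear g ->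
  (forall x m, x \in X -> f (btens X act x m) = g (btens X act x m)) ->
    forall t, f t = g t.
Proof.
move=> lf lg fg t; rewrite -[t](quo_reprK (U := bal_rel X act)).
rewrite (tensor_std_sum (quo_repr t)).
have lc : linear (quo_class (bal_rel X act)) by exact: quo_class_linear.
have E (h : XM -> U) (lh : linear h) : h (quo_class (bal_rel X act)
     (\sum_i \sum_j quo_repr t i j *: (std_basis i \ox std_basis j)))
   = \sum_i \sum_j quo_repr t i j *: h (btens X act (vsval (std_basis i)) (std_basis
     j)).
  rewrite -[LHS]/(to_linear lh (to_linear lc _)) !linear_sum; apply: eq_bigr => i _.
  rewrite !linear_sum; apply: eq_bigr => j _; rewrite !linearZ /=.
  by rewrite /btens vsvalK.
rewrite (E f lf) (E g lg); apply: eq_bigr => i _; apply: eq_bigr => j _.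
by rewrite fg ?subvsP.
Qed.

Definition balanced (U : lmodType k) (phi : subvs_of X -> M -> U) : Prop :=
  bilin phi /\
  forall x a m, phi (vsproj X (vsval x * vsval a)) m = phi x (act a m).

(** Evaluated on the chosen representative, hence linear for every [phi]; independence of the
    representative enters only in [bliftE], for balanced [phi]. *)
Definition blift (U : lmodType k) (phi : subvs_of X -> M -> U) (t : XM) : U :=
  tlift phi (quo_repr t).

Lemma blift_linear (U : lmodType k) (phi : subvs_of X -> M -> U) : linear (blift phi).
Proof. by move=> a s t; rewrite /blift quo_repr_linear tlift_linear. Qed.

Lemma bliftE (U : vectType k) (phi : subvs_of X -> M -> U) x m : balanced phi ->
  blift phi (btens X act x m) = phi (vsproj X x) m.
Proof.
case=> bphi phiA; rewrite /blift /btens -[RHS](tliftE _ _ bphi).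
set t := _ \ox m; have lt := tlift_linear phi.
apply/eqP; rewrite -subr_eq0 -[_ - _]/(to_linear lt _ - to_linear lt _) -linearB /=.
have : quo_repr (quo_class (bal_rel X act) t) - t \in bal_rel X act.
  apply/quo_class_eq0; have lc : linear (quo_class (bal_rel X act)) by exact:
    quo_class_linear.
  by rewrite -[LHS]/(to_linear lc _) linearB /= quo_reprK subrr.
have /subvP sub : (bal_rel X act <= lker (linfun (to_linear lt)))%VS.
  apply: vspan_sub => _ [y [a [m' ->]]].
  rewrite memv_ker lfunE linearB /= !tliftE // phiA.
  by rewrite subrr.
by move/sub; rewrite memv_ker lfunE.
Qed.

Lemma btensor_actE (B : {vspace H}) (b : subvs_of B) x m :
    (forall x a, x \in X -> a \in A -> x * a \in X) ->
    (forall x, x \in X -> vsval b * x \in X) -> x \in X ->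
  btensor_act (X := X) (act := act) b (btens X act x m) = btens X act (vsval b * x) m.
Proof.
move=> XA BX xX; pose phi (y : subvs_of X) m := btens X act (vsval b * vsval y) m.
rewrite -[LHS]/(blift phi _) bliftE; first by rewrite /phi vsprojK.
split=> [|y a n].
  split=> [y|n]; first exact: btens_linearr.
  by move=> a y y'; rewrite /phi linearP mulrDr -scalerAr btens_linearl.
rewrite /phi vsprojK; last by apply: XA; apply: subvsP.
by rewrite mulrA btens_bal // BX // subvsP.
Qed.

End BalancedLift.

Section MackeyIso.
Variables (k : fieldType) (H : hopfAlgType k) (K : {vspace H}).
Variables (M : vectType k) (act : subvs_of K -> M -> M).
Hypothesis KM : forall x y, x \in K -> y \in K -> x * y \in K.
Hypothesis K1 : 1 \in K.

Section Summand.
Variable C : {vspace H}.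
Hypothesis KCK : (K * C * K = C * K)%VS.
Hypothesis K_conj : (K <= conj_hopf C K)%VS.
Local Notation V := (C * K)%VS.
Local Notation mact := (@mackey_act k H K K M act C).

Let VK (x a : H) : x \in V -> a \in K -> x * a \in V.
Proof.
move=> xV aK; apply: (subvP _ _ (memv_mul xV aK)).
by rewrite -prodvA prodvSr //; apply/prodvP.
Qed.

Let KV (a x : H) : a \in K -> x \in V -> a * x \in V.
Proof. by move=> aK xV; rewrite -KCK -prodvA memv_mul. Qed.

Lemma mackey_actE a (x : H) m : x \in V ->
  mact a (btens V act x m) = btens V act (vsval a * x) m.
Proof.
move=> xV; have aK : vsval a \in K by have := subvsP a; rewrite memv_cap => /andP[].
have aE : vsval (vsproj (conj_hopf C K) (vsval a)) = vsval a.
  by rewrite vsprojK // (subvP K_conj).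
rewrite /mackey_act /res_action /conj_act btensor_actE ?aE //.
by move=> y yV; apply: KV.
Qed.

Local Notation summand := (mackey_summand K act C).
Local Notation pure := (mackey_pure K act C).

Lemma pure_linear_x l m : linear (fun x => pure l x m).
Proof.
move=> a x y; rewrite /mackey_pure btens_linearl.
exact: btens_linearr.
Qed.

Lemma pure_linear_m l x : linear (fun m => pure l x m).
Proof.
move=> a m m'; rewrite /mackey_pure btens_linearr.
exact: btens_linearr.
Qed.

Lemma summand_eq (U : lmodType k) (f g : summand -> U) : linear f -> linear g ->
  (forall l x m, l \in K -> x \in V -> f (pure l x m) = g (pure l x m)) ->
  forall t, f t = g t.
Proof.
move=> lf lg fg; apply: btensor_eq => // l t lK.
pose h := to_linear (btens_linearr K mact l).
apply: (@btensor_eq _ _ _ _ _ act _ (fun t => f (h t)) (fun t => g (h t))) =>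
  [||x m xV].
- by move=> a u v; rewrite linearP lf.
- by move=> a u v; rewrite linearP lg.
exact: fg.
Qed.

(** As [K] is contained in the conjugate, the tensor product is balanced over all of [K], and l may
    be moved inside. Thus the summand is no larger than C K tensored with M. *)
Lemma pure_shift (l x : H) m : l \in K -> x \in V -> pure 1 (l * x) m = pure l x m.
Proof.
move=> lK xV; rewrite /mackey_pure.
have lC : l \in (K :&: conj_hopf C K)%VS by rewrite memv_cap lK (subvP K_conj).
have -> : l * x = vsval (vsproj (K :&: conj_hopf C K)%VS l) * x by rewrite vsprojK.
by rewrite -mackey_actE // -btens_bal // vsprojK // mul1r.
Qed.

Definition inner_map (l : H) : conj_mod act C -> induced act :=
  blift (fun (x : subvs_of V) m => btens {:H} act (l * vsval x) m).

Lemma inner_mapE (l x : H) m : x \in V ->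
  inner_map l (btens V act x m) = btens {:H} act (l * x) m.
Proof.
move=> xV; rewrite /inner_map bliftE ?vsprojK //; split=> [|y a n].
  split=> [y|n]; first exact: btens_linearr.
  by move=> a y y'; rewrite linearP mulrDr -scalerAr btens_linearl.
rewrite vsprojK; last by rewrite VK ?subvsP.
by rewrite mulrA btens_bal ?memvf.
Qed.

Definition mackey_map : summand -> induced act :=
  blift (fun (l : subvs_of K) t => inner_map (vsval l) t).

Lemma mackey_map_linear : linear mackey_map.
Proof. exact: blift_linear. Qed.

Lemma mackey_mapE (l x : H) m : l \in K -> x \in V ->
  mackey_map (pure l x m) = btens {:H} act (l * x) m.
Proof.
move=> lK xV; rewrite /mackey_map /mackey_pure bliftE ?vsprojK ?inner_mapE //.
have lin_inner l' : linear (inner_map l') by exact: blift_linear.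
split=> [|y a t].
  split=> [y|t]; first exact: lin_inner.
  apply: linear_tlift_fun => x' m' b y y'.
  by rewrite linearP mulrDl -scalerAl btens_linearl.
have aK : vsval a \in K by have := subvsP a; rewrite memv_cap => /andP[].
rewrite vsprojK; last by rewrite KM ?subvsP.
have lact : linear (mact a) by exact: blift_linear.
apply: (btensor_eq (f := fun t => inner_map _ t) (g := fun t =>
  inner_map _ (mact a t))) t.
- exact: lin_inner.
- by move=> b u v; rewrite lact lin_inner.
by move=> x' m' xV'; rewrite mackey_actE // !inner_mapE ?KV // mulrA.
Qed.

Lemma mackey_map_act (l : subvs_of K) t :
  mackey_map (btensor_act l t) = btensor_act l (mackey_map t).
Proof.
have lact (X : {vspace H}) (A : {vspace H}) (N : vectType k) (act' : subvs_of A -> N ->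
  N) :
    linear (btensor_act (X := X) (act := act') l) by exact: blift_linear.
move: t; apply: summand_eq.
- by move=> a u v; rewrite lact mackey_map_linear.
- by move=> a u v; rewrite mackey_map_linear lact.
move=> l' x m lK xV; rewrite mackey_mapE // btensor_actE ?memvf //.
rewrite {1}/mackey_pure btensor_actE //.
- by rewrite -/(pure (vsval l * l') x m) mackey_mapE ?KM ?subvsP // mulrA.
- by move=> y a yK; rewrite memv_cap => /andP[aK _]; apply: KM.
- by move=> y yK; rewrite KM ?subvsP.
- by move=> *; apply: memvf.
- by move=> *; apply: memvf.
Qed.

Variable p : {linear H -> H}.
Hypothesis pV : forall h, p h \in V.
Hypothesis pK : forall h a, a \in K -> p (h * a) = p h * a.

(** The component of the inverse: h is projected to C K by [p], whose right [K]-linearity [pK] makes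
    the formula balanced. *)
Definition mackey_inv : induced act -> summand :=
  blift (fun (h : subvs_of {:H}) m => pure 1 (p (vsval h)) m).

Lemma mackey_inv_linear : linear mackey_inv.
Proof. exact: blift_linear. Qed.

Lemma mackey_invE h m : mackey_inv (btens {:H} act h m) = pure 1 (p h) m.
Proof.
rewrite /mackey_inv bliftE ?vsprojK ?memvf //; split=> [|y a n].
  split=> [y|n]; first exact: pure_linear_m.
  have lp : linear (fun y : subvs_of {:H} => p (vsval y)).
    by apply: linear_app; apply: linearP.
  by move=> a y y'; rewrite lp pure_linear_x.
by rewrite vsprojK ?memvf // pK ?subvsP // /mackey_pure btens_bal.
Qed.

End Summand.

Lemma mackey_iso n (C : 'I_n -> {vspace H}) (p : 'I_n -> {linear H -> H}) :
    (forall i, (K * C i * K = C i * K)%VS) -> (forall i, (K <= conj_hopf (C i) K)%VS) ->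
    (forall i h, p i h \in (C i * K)%VS) -> (forall h, \sum_i p i h = h) ->
    (forall i j h, h \in (C j * K)%VS -> p i h = if i == j then h else 0) ->
  exists f : forall i : 'I_n, {linear mackey_summand K act (C i) -> induced act},
    [/\ forall i (l x : H) m, l \in K -> x \in (C i * K)%VS ->
          f i (mackey_pure K act (C i) l x m) = btens {:H} act (l * x) m,
        forall i (l : subvs_of K) t,
          f i (btensor_act l t) = btensor_act l (f i t)
      & bijective (fun u : {dffun forall i, mackey_summand K act (C i)} =>
          \sum_i f i (u i))].
Proof.
move=> KCK Kc pV p1 pC.
have VK i x a : x \in (C i * K)%VS -> a \in K -> x * a \in (C i * K)%VS.
  move=> xV aK; apply: (subvP _ _ (memv_mul xV aK)).
  by rewrite -prodvA prodvSr //; apply/prodvP.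
have KV i l x : l \in K -> x \in (C i * K)%VS -> l * x \in (C i * K)%VS.
  by move=> lK xV; rewrite -KCK -prodvA memv_mul.
(* Decompose h first: each p_j(h) a stays in C_j K, so p_i keeps only the term j = i. *)
have pK i h a : a \in K -> p i (h * a) = p i h * a.
  move=> aK; rewrite -{1}(p1 h) mulr_suml linear_sum (bigD1 i) //= big1 ?addr0.
    by rewrite (pC i i) ?eqxx // VK.
  by move=> j ji; rewrite (pC i j) ?VK // eq_sym (negPf ji).
pose f i := to_linear (@mackey_map_linear (C i)).
have fE i l x m : l \in K -> x \in (C i * K)%VS ->
    f i (mackey_pure K act (C i) l x m) = btens {:H} act (l * x) m.
  by move=> lK xV; apply: mackey_mapE.
pose g i := to_linear (@mackey_inv_linear (C i) (p i)).
have gE i h m : g i (btens {:H} act h m) = mackey_pure K act (C i) 1 (p i h) m.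
  by apply: mackey_invE => //; apply: pK.
exists f; split=> //; first by move=> i l t; apply: mackey_map_act.
(* On the image of the j-th summand p_i is the identity for i = j and zero otherwise, so the
   composite is diagonal; [pure_shift] restores l on the outside. *)
exists (fun q => finfun (fun i => g i q)) => [u|q].
  apply/ffunP => j; rewrite ffunE linear_sum (bigD1 j) //= big1 ?addr0.
    apply: (summand_eq (f := fun t => g j (f j t)) (g := id)) => //.
      by move=> a s t; rewrite !linearP.
    move=> l x m lK xV; rewrite fE // gE (pC j j) ?eqxx ?KV //.
    exact: pure_shift.
  move=> i ij; apply: (summand_eq (f := fun t => g j (f i t)) (g := fun=> 0)) => //.
  - by move=> a s t; rewrite !linearP.
  - by move=> a s t; rewrite scaler0 addr0.
  move=> l x m lK xV; rewrite fE // gE (pC j i) ?KV // eq_sym (negPf ij).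
  by rewrite -[LHS]/(to_linear (pure_linear_x (C j) 1 m) 0) linear0.
under eq_bigr do rewrite ffunE.
apply: (btensor_eq (f := fun q => \sum_i f i (g i q)) (g := id)) => [||h m _] //.
  move=> a s t; rewrite scaler_sumr -big_split; apply: eq_bigr => i _.
  by rewrite !linearP.
transitivity (\sum_i btens {:H} act (p i h) m).
  by apply: eq_bigr => i _; rewrite gE fE ?mul1r.
by rewrite -[in RHS](p1 h) -[RHS]/(to_linear (btens_linearl _ _ _) _) linear_sum.
Qed.

End MackeyIso.

Theorem proposition66 (k : closedFieldType) (k_char0 : [pchar k] =i pred0)
    (H : hopfAlgType k) (H_ss : semisimple_alg H)
    (K : {vspace H}) (K_normal : normal_hopf_subalg K) :
  mackey_pair K K.
Proof.
move=> M act _ n C repC.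
have [lam [lam1 lam_r lam_l lam_nak S_surj]] := exists_cointegral k_char0 H_ss.
have [[K1 KM cK _] _ _] := K_normal.
have [p [pV p1 pC]] := normal_decomposition lam1 lam_r lam_l lam_nak S_surj K_normal
  repC.
have cC i : subcoalg (C i) by case: repC => /(_ i)[].
apply: mackey_iso pV p1 pC => //.
- by move=> i; apply: normal_dcoset.
- by move=> i; apply: (normal_sub_conj lam1 lam_r lam_l).
Qed.
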